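(* If $G$ is an almost wheel-free 3-connected graph, then $G$ contains two disjoint pairs of twins.
   Context: Graphs are finite, simple and undirected. A wheel $(C,v)$ in a graph $G$ consists of a cycle $C$ of $G$ (as a subgraph, not necessarily induced) and a vertex $v\in V(G)\setminus V(C)$ (the center) having at least three neighbors in $V(C)$. $W(G)$ denotes the set of all vertices $u$ of $G$ such that at least one wheel of $G$ is centered at $u$. A graph $G$ is almost wheel-free if $W(G)$ is either empty, or made of a single vertex of degree 3 in $G$, or made of two adjacent vertices, both of degree 3 in $G$. Two distinct vertices $u$ and $v$ of a graph are twins if they are non-adjacent, of degree 3, and $N(u)=N(v)$; then $\{u,v\}$ is a pair of twins. *)

(* Defs.v *)
From mathcomp Require Import all_boot.

Set Implicit Arguments.
Unset Strict Implicit.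
Unset Printing Implicit Defensive.

(* A finite simple undirected graph is a symmetric irreflexive relation
   e : rel T on a finite type T of vertices.  Symmetry and irreflexivity are
   hypotheses of the theorem; the definitions below make sense for any e. *)

Section Graphs.

Variables (T : finType) (e : rel T).

Definition nbhd (v : T) : {set T} := [set u | e v u].

Definition degree (v : T) : nat := #|nbhd v|.

(* Adjacency in the graph obtained by deleting the vertices in S. *)
Definition del_rel (S : {set T}) : rel T :=
  [rel x y | [&& x \notin S, y \notin S & e x y]].

(* More than k vertices, and deleting fewer than k vertices never
   disconnects the graph. *)
Definition k_connected (k : nat) : Prop :=
  k < #|T| /\
  forall S : {set T}, #|S| < k ->
    forall x y : T, x \notin S -> y \notin S -> connect (del_rel S) x y.

(* A cycle subgraph, not necessarily induced, is given by listing its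
   vertices in cyclic order; ucycle alone would accept sequences of length
   at most 2. *)
Definition is_cycle (C : seq T) : bool := (2 < size C) && ucycleb e C.

Definition is_wheel (C : seq T) (v : T) : bool :=
  [&& is_cycle C, v \notin C & 2 < #|[set u in C | e v u]|].

(* The membership predicate of W(G). *)
Definition wheel_center (v : T) : Prop := exists C : seq T, is_wheel C v.

Definition almost_wheel_free : Prop :=
  [\/ forall w, ~ wheel_center w,
      exists2 u, degree u = 3 & forall w, wheel_center w <-> w = u
    | exists u v, [/\ e u v, degree u = 3, degree v = 3 &
                      forall w, wheel_center w <-> w = u \/ w = v]].

Definition twins (u v : T) : bool :=
  [&& u != v, ~~ e u v, degree u == 3, degree v == 3 & nbhd u == nbhd v].

End Graphs.

(* Main.v *)
(** In a 3-connected graph every vertex of a triangle is the center of a wheel,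
    so an almost wheel-free 3-connected graph G is triangle-free.

    Suppose first that every 3-vertex cut isolates a single vertex.  Let v be
    a non-center with neighbors a1, a2, a3, and C a cycle of G - v through a2
    and a3.  Of three disjoint paths from a1 to C, two end on the same arc of C
    between a2 and a3, giving a cycle through a1, a2, a3 in G - v; so there are
    no such paths, and by Menger a 3-cut isolates a1, which has degree 3.  Hence
    G is cubic.  For the same reason G - v has no cycle through a1 that is
    disjoint from a cycle through a2 and a3.  Now G - v contains a theta
    with a1, a2, a3 inside its three paths, and any path joining the two ends
    of the theta in G - {v, a1, a2, a3} would create one of the two forbidden
    configurations.  So {a1, a2, a3} has three sides, all of them single
    vertices, and G = K_{3,3}.

    Otherwise take a 3-cut S with at least two vertices on both sides.  Each
    side contains a pair of twins: take a minimal side F inside it.  If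
    |F| = 2 then F is a pair of twins.  If |F| > 2, collapse the complement of
    F and S to one vertex r; the result is 3-connected, all its 3-cuts isolate
    a vertex, and its wheel centers other than r are wheel centers of G, so by
    the first case it is K_{3,3} and |F| = 2. *)

Require Import Defs.
From mathcomp Require Import all_boot zify.

Set Implicit Arguments.
Unset Strict Implicit.
Unset Printing Implicit Defensive.

(** * Menger's theorem *)

Section Menger.

Variable T : finType.
Implicit Types (r : rel T) (A B X : {set T}) (x y z : T) (p q : seq T).

Lemma del_rel_path r X x p :
  path (del_rel r X) x p -> path r x p /\ {in p, forall y, y \notin X}.
Proof.
move=> h; split; first by apply: sub_path h => a b /and3P[].
elim: p x h => //= y p IH x /andP[/and3P[_ yX _] /IH hp] w.
by rewrite inE => /predU1P[-> //|]; apply: hp.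
Qed.

Lemma path_del_rel r X x p :
  path r x p -> {in x :: p, forall y, y \notin X} -> path (del_rel r X) x p.
Proof.
elim: p x => //= y p IH x /andP[hxy hp] hX.
rewrite /del_rel /= hxy hX ?inE ?eqxx //= hX ?inE ?eqxx ?orbT //= IH // => w hw.
by rewrite hX // inE hw orbT.
Qed.

Definition separates r A B X :=
  [forall a in A, forall b in B,
    [|| a \in X, b \in X | ~~ connect (del_rel r X) a b]].

Lemma separatesP r A B X :
  reflect (forall x p, path r x p -> x \in A -> last x p \in B ->
             has [in X] (x :: p))
          (separates r A B X).
Proof.
apply: (iffP 'forall_in_forall_inP) => [h x p hp xA lB | h a aA b bB].
  apply/negPn/negP => /hasPn hX; case/or3P: (h _ xA _ lB).
  - by apply/negP; apply: hX; rewrite inE eqxx.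
  - by apply/negP; apply: hX; rewrite mem_last.
  - by move/negP; apply; apply/connectP; exists p => //; apply: path_del_rel.
case aX: (a \in X) => //=; case bX: (b \in X) => //=.
apply/negP => /connectP[p /del_rel_path[hp hX] def_b].
have /hasP[w] : has [in X] (a :: p) by apply: h => //; rewrite -def_b.
by rewrite inE => /predU1P[-> | /hX /negP //]; rewrite /= aX.
Qed.

Definition abpath r A B p :=
  if p is x :: q then [&& path r x q, uniq p, x \in A & last x q \in B]
  else false.

(** The set [I] only supplies names for the paths; as its elements are vertices, the vertices of a
    separator can serve as names when linkages are glued. *)
Definition linked r A B k := exists (I : {set T}) (f : T -> seq T),
  [/\ k <= #|I|, {in I, forall i, abpath r A B (f i)}
    & {in I &, forall i j z, z \in f i -> z \in f j -> i = j}].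

Lemma linked_sub r r' A B k : subrel r r' -> linked r A B k -> linked r' A B k.
Proof.
move=> rr' [I [f [kI hf fI]]]; exists I, f; split=> // i /hf.
by case: (f i) => //= x q /and4P[/(sub_path rr') -> -> -> ->].
Qed.

(** Leaving the first path at [z] for the second gives a walk from [A] to [B], which [S] must hit. A
    hit beyond [z] on the second path would be its start, visited twice; a hit on the first is its
    end, so that [z] is this end. *)
Lemma separator_crossing r A B S x p y q z :
  separates r A B S -> path r x p -> uniq (x :: p) -> x \in A ->
  path r y q -> uniq (y :: q) -> last y q \in B ->
  {in S, forall s, s \in x :: p -> s = last x p} ->
  {in S, forall s, s \in y :: q -> s = y} ->
  z \in x :: p -> z \in y :: q -> z = last x p /\ z \in S.
Proof.
move=> /separatesP sepS hp up xA hq uq lB Sp Sq zp zq.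
case/splitPl: zp hp up Sp => p1 p2 lz hp up Sp.
case/splitPl: zq hq uq Sq lB => q1 q2 lz' hq uq Sq lB.
have /hasP[s] : has [in S] (x :: (p1 ++ q2)).
  apply: sepS => //.
    move: hp hq; rewrite !cat_path lz lz' => /andP[-> _] /andP[_ ->] //.
  by rewrite last_cat lz; move: lB; rewrite last_cat lz'.
rewrite -cat_cons mem_cat /= => /orP[sp | sq] sS; last first.
  move: uq; rewrite -(Sq s sS) -?cat_cons ?mem_cat ?sq ?orbT //.
  by rewrite /= mem_cat sq orbT.
have sl : s = last x (p1 ++ p2) by apply: Sp => //; rewrite -cat_cons mem_cat sp.
move: up; rewrite -cat_cons cat_uniq => /and3P[_ /hasPn up _].
case: p2 sl up {hp Sp} => [|b p2] sl up; first by rewrite cats0 in sl *; rewrite -lz -sl.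
have := up s; rewrite {1}sl last_cat /= mem_last => /(_ isT) /negP[].
exact: sp.
Qed.

(* Goering's proof: deleting an arc (x, y), either the minimum size of a
   separator is unchanged, or some S with |S| < k separates in the smaller
   graph; then S + x and S + y have size k, and linkages from A to S + x and
   from S + y to B are glued along S and (x, y). *)
Theorem menger r A B k :
  (forall X, separates r A B X -> k <= #|X|) -> linked r A B k.
Proof.
have [n] := ubnP #|[set a : T * T | r a.1 a.2]|.
elim: n r A B => // n IH r A B lt_rn sepk.
case: (pickP [pred a : T * T | r a.1 a.2]) => [[x y] /= rxy | r0]; last first.
  (* Without arcs all paths are trivial, and [A :&: B] separates [A] from [B]. *)
  exists (A :&: B), (fun x => [:: x]); split.
  - apply: sepk; apply/separatesP => x [|y p] /=; last first.
      by case/andP=> rxy; have := r0 (x, y); rewrite /= rxy.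
    by move=> _ xA xB; rewrite inE xA xB.
  - by move=> i; rewrite inE /= => ->.
  - by move=> i j _ _ z; rewrite !inE => /eqP -> /eqP.
pose r' := [rel u w | r u w && ((u, w) != (x, y))].
have r'r : subrel r' r by move=> u w /andP[].
have ltr' : #|[set a : T * T | r' a.1 a.2]| < n.
  rewrite -ltnS (leq_trans _ lt_rn) // ltnS; apply: proper_card.
  apply/properP; split; first by apply/subsetP=> a; rewrite !inE => /andP[].
  by exists (x, y); rewrite !inE /= ?rxy ?eqxx.
case: (pickP [pred S : {set T} | separates r' A B S & #|S| < k]); last first.
  move=> h; apply: (linked_sub r'r); apply: IH => // X sX.
  by have := h X; rewrite /= sX /= ltnNge => /negbFE.
move=> S /= /andP[sepS ltSk].
(* The arc [(x, y)] is avoided by a path that meets [x] at most at its end, and by one that meets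
   [y] at most at its start. *)
have path_r' u p : path r u p -> x \notin belast u p -> path r' u p.
  elim: p u => //= w p IHp u /andP[ruw /IHp hp].
  rewrite inE negb_or => /andP[nxu /hp ->].
  by rewrite ruw xpair_eqE eq_sym (negPf nxu).
have path_r'y u p : path r u p -> y \notin p -> path r' u p.
  elim: p u => //= w p IHp u /andP[ruw /IHp hp].
  rewrite inE negb_or => /andP[nxu /hp ->].
  by rewrite ruw xpair_eqE (eq_sym w) (negPf nxu) andbF.
have sepx : separates r A B (x |: S).
  apply/separatesP => u p hp uA lB; case: (boolP (x \in u :: p)) => [xp|].
    by apply/hasP; exists x => //=; rewrite !inE eqxx.
  rewrite lastI mem_rcons inE negb_or => /andP[_ /(path_r' _ _ hp) hp'].
  have /separatesP/(_ u p hp' uA lB)/hasP[s sp sS] := sepS.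
  by rewrite -lastI; apply/hasP; exists s => //=; rewrite !inE sS orbT.
have sepy : separates r A B (y |: S).
  apply/separatesP => u p hp uA lB; case: (boolP (y \in u :: p)) => [yp|].
    by apply/hasP; exists y => //=; rewrite !inE eqxx.
  rewrite inE negb_or => /andP[_ /(path_r'y _ _ hp) hp'].
  have /separatesP/(_ u p hp' uA lB)/hasP[s sp sS] := sepS.
  by apply/hasP; exists s => //=; rewrite !inE sS orbT.
have xS : x \notin S.
  apply: contraTN ltSk => xS; rewrite -leqNgt; apply: leq_trans (sepk _ sepx) _.
  by apply: subset_leq_card; rewrite subUset sub1set xS subxx.
have yS : y \notin S.
  apply: contraTN ltSk => yS; rewrite -leqNgt; apply: leq_trans (sepk _ sepy) _.
  by apply: subset_leq_card; rewrite subUset sub1set yS subxx.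
have cX : #|x |: S| = k.
  by apply/eqP; rewrite eqn_leq sepk // andbT cardsU1 xS add1n.
have cY : #|y |: S| = k.
  by apply/eqP; rewrite eqn_leq sepk // andbT cardsU1 yS add1n.
have firstin (P : pred T) u p : has P (u :: p) ->
    exists p1 p2, [/\ p = p1 ++ p2, P (last u p1) & ~~ has P (belast u p1)].
  elim: p u => [|w p IHp] u /=; first by rewrite orbF => Pu; exists [::], [::].
  case Pu: (P u) => /=; first by exists [::], (w :: p).
  case/IHp => p1 [p2 [-> h1 h2]]; exists (w :: p1), p2; split=> //=.
  by rewrite Pu.
(* Cut an [A]-[B] path at its first vertex in [x |: S]: the initial piece avoids the arc, so [Q]
   hits it. Hence [Q] also separates [A] from [B] for [r]. *)
have [I [f [cI hf fI]]] : linked r' A (x |: S) k.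
  apply: IH => // Q sepQ; apply: sepk; apply/separatesP => u p hp uA lB.
  have /separatesP/(_ u p hp uA lB)/firstin[p1 [p2 [def_p Pl Pn]]] := sepx.
  have hp1 : path r' u p1.
    move: hp; rewrite def_p cat_path => /andP[hp _]; apply: path_r' => //.
    by apply: contra Pn => xp; apply/hasP; exists x => //=; rewrite !inE eqxx.
  have /separatesP/(_ u p1 hp1 uA Pl)/hasP[s sp sQ] := sepQ.
  by apply/hasP; exists s => //; rewrite def_p -cat_cons mem_cat sp.
have lastin (P : pred T) u p : has P (u :: p) ->
    exists p1 p2, [/\ p = p1 ++ p2, P (last u p1) & ~~ has P p2].
  elim: p u => [|w p IHp] u; first by rewrite /= orbF => Pu; exists [::], [::].
  case Pp: (has P (w :: p)).
    by case: (IHp _ Pp) => p1 [p2 [-> h1 h2]]; exists (w :: p1), p2.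
  by rewrite [has _ _]/= orbC -/(has P (w :: p)) Pp /= => Pu; exists [::], (w :: p); rewrite Pp.
(* Symmetrically, with the final piece that starts at the last vertex in [y |: S]. *)
have [J [g [cJ hg gJ]]] : linked r' (y |: S) B k.
  apply: IH => // Q sepQ; apply: sepk; apply/separatesP => u p hp uA lB.
  have /separatesP/(_ u p hp uA lB)/lastin[p1 [p2 [def_p Pl Pn]]] := sepy.
  have hp2 : path r' (last u p1) p2.
    move: hp; rewrite def_p cat_path => /andP[_ hp]; apply: path_r'y => //.
    by apply: contra Pn => yp; apply/hasP; exists y => //=; rewrite !inE eqxx.
  have lB2 : last (last u p1) p2 \in B by move: lB; rewrite def_p last_cat.
  have /separatesP/(_ _ p2 hp2 Pl lB2)/hasP[s sp sQ] := sepQ.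
  apply/hasP; exists s => //; rewrite def_p -cat_cons mem_cat.
  move: sp; rewrite inE => /predU1P[-> | ->]; last by rewrite orbT.
  by rewrite mem_last.
(* At least [k] disjoint paths end in [x |: S], which has [k] vertices, so each of these is the end
   of one of them. *)
have hx s : s \in x |: S -> exists2 i, i \in I & last x (f i) = s.
  suff -> : x |: S = [set last x (f i) | i in I] by case/imsetP => i iI ->; exists i.
  apply/esym/eqP; rewrite eqEcard cX card_in_imset ?cI ?andbT //.
    apply/subsetP => w /imsetP[i /hf + ->].
    by case: (f i) => //= u p /and4P[].
  move=> i j iI jI eql; apply: (fI i j iI jI (last x (f i))); last rewrite eql.
    by case: (f i) (hf i iI) => // u p _; rewrite /= mem_last.
  by case: (f j) (hf j jI) => // u p _; rewrite /= mem_last.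
have hy s : s \in y |: S -> exists2 i, i \in J & head y (g i) = s.
  suff -> : y |: S = [set head y (g i) | i in J] by case/imsetP => i iI ->; exists i.
  apply/esym/eqP; rewrite eqEcard cY card_in_imset ?cJ ?andbT //.
    apply/subsetP => w /imsetP[i /hg + ->].
    by case: (g i) => //= u p /and4P[].
  move=> i j iI jI eql; apply: (gJ i j iI jI (head y (g i))); last rewrite eql.
    by case: (g i) (hg i iI) => // u p _; rewrite /= inE eqxx.
  by case: (g j) (hg j jI) => // u p _; rewrite /= inE eqxx.
have /fin_all_exists[a ha] s : exists i, s \in x |: S -> i \in I /\ last x (f i) = s.
  case: (boolP (s \in x |: S)) => [/hx[i]|]; last by exists x.
  by exists i.
have /fin_all_exists[b hb] s : exists i, s \in y |: S -> i \in J /\ head y (g i) = s.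
  case: (boolP (s \in y |: S)) => [/hy[i]|]; last by exists x.
  by exists i.
have meet s t z : s \in x |: S -> t \in y |: S -> z \in f (a s) -> z \in g (b t) ->
    [/\ s = t, z = s & s \in S].
  move=> sX tY; have [aI la] := ha s sX; have [bJ hb'] := hb t tY.
  have Sf u : u \in S -> u \in f (a s) -> u = s.
    move=> uS uf; have uX : u \in x |: S by rewrite !inE uS orbT.
    have [auI lu] := ha u uX; rewrite -lu -la; congr (last x (f _)).
    apply: (fI _ _ auI aI u) => //; rewrite -[X in X \in _]lu.
    by case: (f _) (hf _ auI) => // ? ? _; rewrite /= mem_last.
  have Sg u : u \in S -> u \in g (b t) -> u = t.
    move=> uS uf; have uX : u \in y |: S by rewrite !inE uS orbT.
    have [auI lu] := hb u uX; rewrite -lu -hb'; congr (head y (g _)).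
    apply: (gJ _ _ auI bJ u) => //; rewrite -[X in X \in _]lu.
    by case: (g _) (hg _ auI) => // ? ? _; rewrite /= inE eqxx.
  case: (f (a s)) (hf _ aI) la Sf => // u p /and4P[p1 p2 p3 _] /= la Sf.
  case: (g (b t)) (hg _ bJ) hb' Sg => // v q /and4P[q1 q2 _ q4] /= hb' Sg zp zq.
  have [||zl zS] := separator_crossing sepS p1 p2 p3 q1 q2 q4 _ _ zp zq.
  - by move=> w wS wp; rewrite la; apply: Sf.
  - by move=> w wS wp; rewrite hb'; apply: Sg.
  by have zs := Sf z zS zp; split; rewrite -?(Sg z zS zq) -zs.
(* The path that ends at [s] is continued by the one that starts at [c s]: across the arc [(x, y)]
   if [s = x], from [s] itself otherwise. *)
pose c s := if s == x then y else s.
have cs s : s \in x |: S -> c s \in y |: S.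
  by rewrite /c !inE; case: eqP => [_|_ /= ->]; rewrite ?eqxx ?orbT.
exists (x |: S), (fun s => f (a s) ++ if s == x then g (b y) else behead (g (b s))).
split; first by rewrite cX.
  move=> s sX; have [aI la] := ha s sX.
  have := cs s sX; rewrite /c; case: eqP sX aI la => [-> xX aI la yY|/eqP nsx sX aI la sY].
    have [bJ lb] := hb y yY; move: (hf _ aI) (hg _ bJ) (fun z => meet x y z xX yY) la lb.
    case: (f (a x)) => //= u p /and4P[p1 p2 p3 p4].
    case: (g (b y)) => //= v q /and4P[q1 q2 _ q4] mt la lb.
    subst v; rewrite cat_path last_cat /= la rxy !(sub_path r'r) // p3 q4.
    rewrite -[_ && uniq _]/(uniq ((u :: p) ++ y :: q)) cat_uniq.
    rewrite (p2 : uniq (u :: p)) (q2 : uniq (y :: q)) andTb ?andbT.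
    apply/hasPn => w wq.
    by apply/negP => wp; have [_ _] := mt w wp wq; rewrite (negPf xS).
  have [bJ lb] := hb s sY; move: (hf _ aI) (hg _ bJ) (fun z => meet s s z sX sY) la lb.
  case: (f (a s)) => //= u p /and4P[p1 p2 p3 p4].
  case: (g (b s)) => //= v q /and4P[q1 /andP[nvq uq] _ q4] mt la lb.
  rewrite cat_path last_cat /= la -lb !(sub_path r'r) // p3 q4.
  rewrite -[_ && uniq _]/(uniq ((u :: p) ++ q)) cat_uniq (p2 : uniq (u :: p)) uq.
  rewrite andTb ?andbT; apply/hasPn => w wq.
  apply/negP => wp; have [|_ ws _] := mt w wp; first by rewrite inE wq orbT.
  by move: nvq; rewrite lb -ws wq.
move=> i j iX jX z; have [aI lai] := ha i iX; have [aJ laj] := ha j jX.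
have [bI lbi] := hb _ (cs i iX); have [bJ lbj] := hb _ (cs j jX).
have gin s : z \in (if s == x then g (b y) else behead (g (b s))) -> z \in g (b (c s)).
  by rewrite /c; case: eqP => // _; apply: mem_behead.
have cS s t : s \in x |: S -> s = c t -> s \in S -> s = t.
  rewrite /c; case: eqP => // -> _ ->; by rewrite (negPf yS).
rewrite !mem_cat => /orP[zi|/gin zi] /orP[zj|/gin zj].
- by rewrite -lai -laj (fI _ _ aI aJ z).
- by have [/cS h _ /h] := meet i _ z iX (cs j jX) zi zj; apply.
- by have [/cS h _ /h ->] := meet j _ z jX (cs i iX) zj zi.
have : c i = c j by rewrite -lbi -lbj (gJ _ _ bI bJ z).
rewrite /c; case: eqP => [->|nix]; case: eqP => [->|njx] // eqy.
  by move: jX; rewrite !inE -eqy (negPf yS) orbF eqy => /eqP.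
by move: iX; rewrite !inE eqy (negPf yS) orbF -eqy => /eqP.
Qed.

End Menger.

(** * Disjoint paths and fans that avoid a set *)

Section Legs.

Variables (T : finType) (e : rel T).
Implicit Types (A B D F K X Z : {set T}) (a x y z w : T) (b p q s : seq T).

Definition closed_up_to F Z := forall x y, x \in F -> e x y -> y \in F :|: Z.

Lemma del_rel_connect_notin X x y :
  connect (del_rel e X) x y -> x \notin X -> y \notin X.
Proof.
case/connectP=> p /del_rel_path[_ hp] -> xX.
by have := mem_last x p; rewrite in_cons => /orP[/eqP-> | /hp].
Qed.

(** Menger's theorem after deleting [D]. A small separator [X] is replaced by the set [F] of the
    vertices still reachable from [A], the form in which connectivity is used below. *)
Lemma menger_cut A B D k : [disjoint A & D] ->
  (exists X F, [/\ #|X| < k, A \subset F :|: X, [disjoint F & X :|: D :|: B]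
                 & closed_up_to F (X :|: D)])
  \/ linked (del_rel e D) A B k.
Proof.
move=> dAD.
case: (pickP [pred X : {set T} | separates (del_rel e D) A B X & #|X| < k]); last first.
  move=> h; right; apply: menger => X sX.
  by have := h X; rewrite /= sX /= ltnNge => /negbFE.
move=> X /= /andP[sepX ltX]; left.
exists X, [set y in ~: (X :|: D) | [exists a in A, connect (del_rel (del_rel e D) X) a y]].
split=> //.
- apply/subsetP => a aA; rewrite !inE.
  case: (boolP (a \in X)) => [_|aX]; first by rewrite orbT.
  rewrite /= (disjointFr dAD aA) //= orbF; apply/existsP; exists a.
  by rewrite aA connect0.
- apply/pred0P => y /=; rewrite !inE; apply/negbTE/negP.
  move=> /andP[/andP[/norP[yX yD] /existsP[a /andP[aA ay]]]].
  rewrite (negPf yX) (negPf yD) /= => yB.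
  have /forall_inP/(_ a aA)/forall_inP/(_ y yB) := sepX.
  rewrite (negPf yX) ay orbF.
  by case/connectP: ay => [[|c p]] /=;
    [move=> _ ey; rewrite -ey (negPf yX)|move=> /andP[/and3P[/negPf->]]].
- move=> x y; rewrite !inE => /andP[/norP[xX xD] /existsP[a /andP[aA ax]]] exy.
  case: (boolP (y \in X)) => [|yX]; first by rewrite orbT.
  case: (boolP (y \in D)) => [|yD]; first by rewrite !orbT.
  rewrite /= orbF; apply/existsP; exists a; rewrite aA /=.
  by apply: connect_trans ax (connect1 _); rewrite /del_rel /= xX yX xD yD.
Qed.

(** Cut off everything before a later visit to [A] or after an earlier visit to [B], and repeat. *)
Lemma trim_abpath (r : rel T) A B p : abpath r A B p ->
  exists x q, [/\ {subset x :: q <= p}, path r x q, uniq (x :: q) &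
    [/\ x \in A, last x q \in B, {in q, forall w, w \notin A}
      & {in belast x q, forall w, w \notin B}]].
Proof.
have [n] := ubnP (size p); elim: n p => // n IH [|x q] //= lt_n /and4P[hq uq xA lB].
have [/hasP[w wq wA]|/hasPn nA] := boolP (has [in A] q).
  case/splitPr: wq hq uq lB lt_n => q1 q2.
  rewrite cat_path last_cat cat_uniq /= => /and3P[_ _ hq2] /and4P[_ _ _ uq2] lB.
  rewrite size_cat /= => lt_n.
  have [||x' [q' [sub]]] := IH (w :: q2); last first.
    by exists x', q'; split=> // y /sub yq; rewrite inE mem_cat yq !orbT.
  - by rewrite /= hq2 uq2 wA.
  - by move: lt_n; rewrite ltnS; apply: leq_trans; rewrite /= ltnS leq_addl.
have [/hasP[w wq wB]|/hasPn nB] := boolP (has [in B] (belast x q)); last first.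
  by exists x, q; split=> // y /nA.
have wq' : w \in x :: q by apply: mem_belast.
case/splitPl: wq' hq uq wq lB lt_n => q1 [|c q2] lw.
  rewrite cats0 -lw => _; rewrite -[_ && _]/(uniq (x :: q1)) lastI rcons_uniq.
  by case/andP=> /negPf->.
rewrite cat_path -[_ && uniq _]/(uniq ((x :: q1) ++ c :: q2)) cat_uniq.
move=> /andP[hq1 _] /and3P[/= uq1 _ _] _ _ lt_n.
have [||x' [q' [sub]]] := IH (x :: q1).
- by move: lt_n; rewrite /= size_cat /= addnS ltnS; apply: leq_trans; rewrite !ltnS leq_addr.
- by rewrite /= hq1 uq1 xA lw wB.
by exists x', q'; split=> // y /sub yq; rewrite -cat_cons mem_cat yq.
Qed.

(** The list [rcons b z] starts after [x], so that several legs may leave the same vertex and still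
    be disjoint as lists. *)
Definition leg D B x b z := [/\ path e x (rcons b z), uniq (rcons b z), z \in B,
  {in b, forall w, w \notin B} & {in rcons b z, forall w, w \notin D}].

(** The last clause covers two forms of Menger's theorem at once: disjoint paths out of a set [K],
    and a fan out of a single vertex. *)
Definition legs K D B k := exists (I : {set T}) (x : T -> T) (b : T -> seq T) (z : T -> T),
  [/\ k <= #|I|, {in I, forall i, x i \in K /\ leg (K :|: D) B (x i) (b i) (z i)},
      {in I &, forall i j w,
         w \in rcons (b i) (z i) -> w \in rcons (b j) (z j) -> i = j}
    & {in I &, forall i j, x i = x j -> i = j \/ K = [set x i]}].

Lemma menger_legs K D B k : [disjoint K & B] -> [disjoint K & D] ->
  (exists X F, [/\ #|X| < k, K \subset F :|: X, [disjoint F & X :|: D :|: B]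
                 & closed_up_to F (X :|: D)])
  \/ legs K D B k.
Proof.
move=> dKB dKD; case: (menger_cut B k dKD) => [|[I [f [kI hf fI]]]]; [by left|right].
have /fin_all_exists[t ht] i : exists t : T * seq T * T, i \in I ->
    [/\ t.1.1 \in K, leg (K :|: D) B t.1.1 t.1.2 t.2
      & {subset t.1.1 :: rcons t.1.2 t.2 <= f i}].
  case: (boolP (i \in I)) => [/hf/trim_abpath[x [q]]|]; last by exists (i, [::], i).
  case=> sub /del_rel_path[hq qD] uq [xK lB qK qB].
  case/lastP: q sub hq qD uq lB qK qB => [|b z] sub hq qD uq lB qK qB.
    by rewrite (disjointFr dKB xK) in lB.
  rewrite last_rcons belast_rcons in lB qB.
  exists (x, b, z) => _ /=; split=> //; split=> //.
  - by case/andP: uq.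
  - by move=> w wb; apply: qB; rewrite inE wb orbT.
  by move=> w wq; rewrite inE negb_or qK ?qD.
exists I, (fun i => (t i).1.1), (fun i => (t i).1.2), (fun i => (t i).2); split=> //.
- by move=> i /ht[].
- move=> i j iI jI w /= wi wj; have [_ _ si] := ht i iI; have [_ _ sj] := ht j jI.
  by apply: (fI _ _ iI jI w); [apply: si|apply: sj]; rewrite inE ?wi ?wj orbT.
move=> i j iI jI /= eqx; left.
have [_ _ si] := ht i iI; have [_ _ sj] := ht j jI.
by apply: (fI _ _ iI jI (t i).1.1); [apply: si|apply: sj]; rewrite inE ?eqx eqxx.
Qed.

(** The fan version: link the neighbors of [a] to [B] with [a] deleted as well, then start every
    path at [a]. In the other case [a] joins the side of its neighbors. *)
Lemma menger_fan a D B k : a \notin D -> a \notin B ->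
  (exists X F, [/\ #|X| < k, a \in F, [disjoint F & X :|: D :|: B]
                 & closed_up_to F (X :|: D)])
  \/ legs [set a] D B k.
Proof.
move=> aD aB; set N := [set y | e a y] :\: (a |: D).
have dN : [disjoint N & a |: D].
  by apply/pred0P => y /=; rewrite !inE; case: (y == a); case: (y \in D); rewrite /= ?andbF.
case: (menger_cut B k dN) => [[X [F [ltX NF dF hF]]]|[I [f [kI hf fI]]]].
  left; exists (X :\ a), (a |: F); split.
  - by apply: leq_ltn_trans ltX; apply/subset_leq_card/subD1set.
  - by rewrite setU11.
  - apply/pred0P => y /=; rewrite !inE; case: (eqVneq y a) => [->|_] /=.
      by rewrite (negPf aD) (negPf aB).
    have /pred0P/(_ y) /= := dF; rewrite !inE.
    by case: (y \in F) => //=; case: (y \in X); case: (y \in D); case: (y == a).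
  move=> x y; rewrite !inE => /predU1P[-> exy|/hF h /h].
    have [//|nya] := eqVneq y a; case yD: (y \in D); first by rewrite !orbT.
    have /subsetP/(_ y) := NF; rewrite !inE exy yD (negPf nya) /=.
    by move=> /(_ isT); rewrite orbF.
  by rewrite !inE; case: (y == a); rewrite ?orbT.
right.
have /fin_all_exists[t ht] i : exists t : seq T * T, i \in I ->
    leg ([set a] :|: D) B a t.1 t.2 /\ {subset rcons t.1 t.2 <= f i}.
  case: (boolP (i \in I)) => [/hf/trim_abpath[x [q]]|]; last by exists ([::], i).
  case=> sub /del_rel_path[hq qD] uq [xN lB qN qB].
  have eax : e a x by move: xN; rewrite !inE => /andP[].
  exists (belast x q, last x q) => _ /=; rewrite -lastI; split=> //; split; rewrite -?lastI //=.
    by rewrite eax.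
  move=> w; rewrite in_cons => /orP[/eqP->|/qD //]; by rewrite (disjointFr dN xN).
exists I, (fun i => a), (fun i => (t i).1), (fun i => (t i).2); split=> //.
- by move=> i /ht[]; rewrite inE eqxx.
- move=> i j iI jI w /= wi wj; have [_ si] := ht i iI; have [_ sj] := ht j jI.
  by apply: (fI _ _ iI jI w); [apply: si|apply: sj].
by move=> i j iI jI _; right.
Qed.

End Legs.

(** * Cycles and ears *)

Section Counts.

Variable T : eqType.
Implicit Types (w : T) (s t : seq T).

Lemma uniq_countP s : (forall w, count_mem w s <= 1) <-> uniq s.
Proof.
split=> [h|us w]; last by rewrite count_uniq_mem // leq_b1.
apply: count_mem_uniq => w; have := h w; rewrite -has_pred1 has_count.
by case: (count_mem w s) => [|[]].
Qed.

Lemma mem_count w s : (w \in s) = (0 < count_mem w s).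
Proof. by rewrite -has_pred1 has_count. Qed.

Lemma count_rcons (P : pred T) s w : count P (rcons s w) = count P s + P w.
Proof. by rewrite -cats1 count_cat /= addn0. Qed.

Lemma disj_countP s t :
  (forall w, count_mem w s = 0 \/ count_mem w t = 0) <-> {in s, forall w, w \notin t}.
Proof.
split=> [h w|h w]; first by rewrite !mem_count; case: (h w) => ->; rewrite // -leqNgt.
case: (posnP (count_mem w s)) => [->|hs]; [by left|right].
by have := h w; rewrite !mem_count hs -leqNgt leqn0 => /(_ isT)/eqP.
Qed.

End Counts.

Definition countE := (count_cat, count_rev, count_rcons, mem_count).

(** Membership, distinctness and disjointness of concatenated lists become linear constraints on the
    multiplicities of one vertex. *)
Ltac count_lia :=
  rewrite /=; do ?[rewrite !countE /=]; rewrite ?eqxx /=;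
  repeat match goal with
  | |- context [count ?P ?s] => let c := fresh "c" in generalize (count P s) => c
  | |- context [#|?A|] => let c := fresh "c" in generalize #|A| => c
  | |- context [nat_of_bool ?b] => let c := fresh "c" in generalize (nat_of_bool b) => c
  end; clear; lia.

Section Cycles.

Variables (T : finType) (e : rel T).
Hypothesis e_sym : symmetric e.
Implicit Types (A B D F K X Z : {set T}) (a v x y z w : T) (C b p q s t : seq T).

Lemma path_rcons_rev x y s :
  path e x (rcons s y) = path e y (rcons (rev s) x).
Proof.
have := rev_path e x (rcons s y); rewrite last_rcons belast_rcons rev_cons => ->.
by apply: eq_path => a b; rewrite /= e_sym.
Qed.

Lemma cycle_of_paths x y s t :
  path e x (rcons s y) -> path e x (rcons t y) -> cycle e (x :: s ++ y :: rev t).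
Proof.
move=> hs ht; rewrite /= rcons_cat rcons_cons cat_path /=.
move: hs; rewrite rcons_path => /andP[-> ->] /=.
by rewrite -path_rcons_rev.
Qed.

Lemma is_cycleE C : is_cycle e C = [&& 2 < size C, cycle e C & uniq C].
Proof. by []. Qed.

Lemma wheelI C v a x y : cycle e C -> uniq C -> v \notin C ->
  [/\ a \in C, x \in C & y \in C] -> [/\ a != x, x != y & y != a] ->
  [/\ e v a, e v x & e v y] -> wheel_center e v.
Proof.
move=> cC uC vC [aC xC yC] ne [ea ex ey].
have h : 2 < #|[set u in C | e v u]|.
  by apply/card_gt2P; exists a, x, y; rewrite !inE aC xC yC ea ex ey.
exists C; rewrite /is_wheel vC h !andbT is_cycleE cC uC !andbT.
rewrite -(card_uniqP uC); apply: leq_trans h _; apply/subset_leq_card/subsetP=> w.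
by rewrite inE => /andP[].
Qed.

Lemma split_cycle C z z' : cycle e C -> uniq C -> z \in C -> z' \in C -> z != z' ->
  exists P Q, [/\ cycle e (z :: P ++ z' :: Q), uniq (z :: P ++ z' :: Q)
                & z :: P ++ z' :: Q =i C].
Proof.
move=> cC uC zC z'C ne; case: (rot_to zC) => i s def_s.
have : z' \in s by move: z'C; rewrite -(mem_rot i) def_s inE eq_sym (negPf ne).
move=> z's; move: def_s; case/splitPr: z's => P Q def_s; exists P, Q.
by rewrite -def_s rot_cycle rot_uniq; split=> // w; rewrite mem_rot.
Qed.

End Cycles.

(** * Ears through one neighbor of a non-center, on a cycle through two others *)

Section Ears.

Variables (T : finType) (e : rel T).
Hypothesis e_sym : symmetric e.
Variables v a1 a2 a3 : T.
Hypothesis v_nocenter : ~ wheel_center e v.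
Hypothesis e_va : [/\ e v a1, e v a2 & e v a3].
Hypothesis neq_a : [/\ a1 != a2, a2 != a3 & a3 != a1].
Implicit Types (A B D F K X Z : {set T}) (x y z w : T) (C P Q R b p q s t : seq T).

Lemma no_wheel C : cycle e C -> uniq C -> v \notin C ->
  a1 \in C -> a2 \in C -> a3 \in C -> False.
Proof.
by move=> cC uC vC h1 h2 h3; apply: v_nocenter; apply: (wheelI cC uC vC _ neq_a).
Qed.

(** Always an ear through [a1] that avoids [v]: put in place of an arc of [C], it gives a cycle of G
    - v through [a1]. *)
Definition ear C z z' := exists q,
  [/\ path e z (rcons q z'), uniq q, a1 \in q, v \notin q
    & {in q, forall w, w \notin C}].

Lemma ear_sym C z z' : ear C z z' -> ear C z' z.
Proof.
case=> q [hq uq aq vq qC]; exists (rev q).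
by rewrite rev_uniq !mem_rev -path_rcons_rev //; split=> // w; rewrite mem_rev; apply: qC.
Qed.

Lemma ear_eq C C' z z' : C =i C' -> ear C z z' -> ear C' z z'.
Proof.
by move=> eqC [q [hq uq aq vq qC]]; exists q; split=> // w; rewrite -eqC; apply: qC.
Qed.

(* Replacing the arc [P] by the ear gives a cycle through [a1]; it must miss
   [a2] or [a3]. *)
Lemma ear_arc z P z' Q : cycle e (z :: P ++ z' :: Q) -> uniq (z :: P ++ z' :: Q) ->
  v \notin z :: P ++ z' :: Q -> a2 \in z :: P ++ z' :: Q -> a3 \in z :: P ++ z' :: Q ->
  ear (z :: P ++ z' :: Q) z z' -> (a2 \in P) || (a3 \in P).
Proof.
move=> cC uC vC a2C a3C [q [hq uq a1q vq qC]]; apply/negPn/negP => /norP[a2P a3P].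
apply: (@no_wheel (z :: q ++ z' :: Q)).
- move: cC; rewrite /= !rcons_cat !rcons_cons !cat_path /= => /and3P[_ _ ->].
  by move: hq; rewrite rcons_path => /andP[-> ->].
- apply/uniq_countP => w; move/uniq_countP/(_ w): uC; move/uniq_countP/(_ w): uq.
  by move/disj_countP/(_ w): qC; count_lia.
- by move: vC vq; count_lia.
- by rewrite inE mem_cat a1q orbT.
- by move: a2C a2P; count_lia.
- by move: a3C a3P; count_lia.
Qed.

(** By [ear_arc] each of the three disjoint arcs contains [a2] or [a3], but these are only two
    vertices. *)
Lemma no_tripod_ordered z1 P z2 Q z3 R (C := z1 :: P ++ z2 :: Q ++ z3 :: R) :
  cycle e C -> uniq C -> v \notin C -> a2 \in C -> a3 \in C ->
  ear C z1 z2 -> ear C z2 z3 -> ear C z3 z1 -> False.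
Proof.
move=> cC uC vC a2C a3C h12 h23 h31.
have hP := ear_arc cC uC vC a2C a3C h12.
have eqr1 : rot (size (z1 :: P)) C = z2 :: Q ++ z3 :: (R ++ z1 :: P).
  by rewrite /C -cat_cons rot_size_cat /= -catA.
have eqr2 : rot (size (z1 :: P ++ z2 :: Q)) C = z3 :: R ++ z1 :: (P ++ z2 :: Q).
  have -> : C = (z1 :: P ++ z2 :: Q) ++ z3 :: R by rewrite /C /= -catA.
  by rewrite rot_size_cat.
have hQ : (a2 \in Q) || (a3 \in Q).
  apply: (@ear_arc z2 Q z3 (R ++ z1 :: P)); rewrite -?eqr1 ?rot_cycle ?rot_uniq ?mem_rot //.
  by apply: ear_eq h23 => w; rewrite mem_rot.
have hR : (a2 \in R) || (a3 \in R).
  apply: (@ear_arc z3 R z1 (P ++ z2 :: Q)); rewrite -?eqr2 ?rot_cycle ?rot_uniq ?mem_rot //.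
  by apply: ear_eq h31 => w; rewrite mem_rot.
move/uniq_countP: uC => uC; have := uC a2; have := uC a3.
by move: hP hQ hR; rewrite /C; count_lia.
Qed.

Lemma no_tripod C z1 z2 z3 : cycle e C -> uniq C -> v \notin C ->
  a2 \in C -> a3 \in C -> [/\ z1 \in C, z2 \in C & z3 \in C] ->
  [/\ z1 != z2, z2 != z3 & z3 != z1] ->
  ear C z1 z2 -> ear C z2 z3 -> ear C z3 z1 -> False.
Proof.
move=> cC uC vC a2C a3C [z1C z2C z3C] [n12 n23 n31] h12 h23 h31.
have [P [Q [cC' uC' eqC]]] := split_cycle cC uC z1C z2C n12.
move: z3C; rewrite -eqC inE mem_cat inE (negPf n31) eq_sym (negPf n23) /=.
case/orP => z3in; case/splitPr: z3in cC' uC' eqC => p1 p2.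
  rewrite -catA cat_cons => cC' uC' eqC.
  apply: (no_tripod_ordered cC' uC'); rewrite ?eqC //; apply: (ear_eq (fsym eqC));
    exact: ear_sym.
move=> cC' uC' eqC.
by apply: (no_tripod_ordered cC' uC'); rewrite ?eqC //; apply: (ear_eq (fsym eqC)).
Qed.

(** Two legs that leave [K] can be joined inside [K] by way of [a1]. The same start for both is
    allowed only when [K] is a single vertex, as in [legs]. *)
Definition joined_through K := forall x y, x \in K -> y \in K ->
  (x = y -> K = [set x]) ->
  exists s, [/\ path e x s, last x s = y, uniq (x :: s), a1 \in x :: s
              & {subset x :: s <= K}].

Lemma joined_through_set1 : joined_through [set a1].
Proof.
move=> x y; rewrite !inE => /eqP-> /eqP-> _; exists [::]; split=> //; first by rewrite inE.
by move=> w; rewrite !inE.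
Qed.

(** Of the two arcs between the given vertices, take the one that contains [a1]. *)
Lemma joined_through_cycle C : cycle e C -> uniq C -> a1 \in C -> 1 < size C ->
  joined_through [set w in C].
Proof.
move=> cC uC aC sC x y; rewrite !inE => xC yC xy.
have nxy : x != y.
  apply/eqP => /xy eqC; move: sC; rewrite -(card_uniqP uC) -cardsE eqC cards1.
  by rewrite ltnn.
have [P [Q [cC' uC' eqC]]] := split_cycle cC uC xC yC nxy.
move: cC'; rewrite /= rcons_cat rcons_cons cat_path /= => /and3P[hP exy hQ].
have := aC; rewrite -eqC -cat_rcons -cat_cons mem_cat => /orP[aP|aQ].
  exists (rcons P y); rewrite last_rcons rcons_path hP; split=> //.
    by move: uC'; rewrite -cat_rcons -cat_cons cat_uniq => /andP[].
  by move=> w wP; rewrite inE -eqC -cat_rcons -cat_cons mem_cat wP.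
exists (rcons (rev Q) y); rewrite last_rcons -path_rcons_rev //; split=> //.
- rewrite -[_ && _]/(uniq (x :: rcons (rev Q) y)).
  apply/uniq_countP => w; move/uniq_countP/(_ w): uC'; count_lia.
- by rewrite inE mem_rcons inE mem_rev aQ !orbT.
move=> w; rewrite [w \in [set _ in _]]inE -eqC !countE /= !countE /=; count_lia.
Qed.

Lemma legs_ear K C x y b z b' z' (B := [set w in C]) : joined_through K ->
  v \notin K -> [disjoint K & B] -> x \in K -> y \in K -> (x = y -> K = [set x]) ->
  leg e (K :|: [set v]) B x b z -> leg e (K :|: [set v]) B y b' z' ->
  {in rcons b z, forall w, w \notin rcons b' z'} -> ear C z z'.
Proof.
move=> joinK vK dKC xK yK xy [hb ub zC bC bD] [hb' ub' zC' bC' bD'] dis.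
have [s [hs ls us a1s sK]] := joinK x y xK yK xy.
have notC w : w \in K -> w \notin C.
  by move=> wK; have := disjointFr dKC wK; rewrite inE => ->.
have sb : {in x :: s, forall w, w \notin rcons b z}.
  by move=> w /sK wK; apply/negP => /bD; rewrite !inE wK.
have sb' : {in x :: s, forall w, w \notin rcons b' z'}.
  by move=> w /sK wK; apply/negP => /bD'; rewrite !inE wK.
exists (rev b ++ (x :: s) ++ b'); split.
- move: hb hb'; rewrite path_rcons_rev // !rcons_path => /andP[h1 h2].
  rewrite -ls => /andP[h3 h4].
  by rewrite !cat_path h1 /= h2 hs h3 !last_cat /= last_cat.
- apply/uniq_countP => w; move/uniq_countP/(_ w): ub; move/uniq_countP/(_ w): ub'.
  move/uniq_countP/(_ w): us; move/disj_countP/(_ w): sb; move/disj_countP/(_ w): sb'.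
  by move/disj_countP/(_ w): dis; count_lia.
- by rewrite !mem_cat a1s orbT.
- rewrite !mem_cat mem_rev; apply/negP => /or3P[vb|/sK|vb].
  + by have := bD v; rewrite mem_rcons inE vb orbT !inE eqxx orbT => /(_ isT).
  + by rewrite (negPf vK).
  by have := bD' v; rewrite mem_rcons inE vb orbT !inE eqxx orbT => /(_ isT).
move=> w; rewrite !mem_cat mem_rev => /or3P[wb|/sK|wb].
- by have := bC w wb; rewrite inE.
- exact: notC.
by have := bC' w wb; rewrite inE.
Qed.

(** Any two of the three legs, joined inside [K] through [a1], form an ear of [C], and three such
    ears contradict [no_tripod]. Every use of the non-center [v] to bound degrees or to exclude
    disjoint cycles goes through this lemma. *)
Lemma no_three_legs K C : joined_through K -> v \notin K -> [disjoint K & [set w in C]] ->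
  cycle e C -> uniq C -> v \notin C -> a2 \in C -> a3 \in C ->
  ~ legs e K [set v] [set w in C] 3.
Proof.
move=> joinK vK dKC cC uC vC a2C a3C [I [x [b [z [cI hI dI xI]]]]].
have /card_gt2P[i [j [k [[iI jI kI] [nij njk nki]]]]] := cI.
have ears i' j' : i' \in I -> j' \in I -> i' != j' -> ear C (z i') (z j').
  move=> iI' jI' nij'; have [xi li] := hI i' iI'; have [xj lj] := hI j' jI'.
  apply: (legs_ear joinK vK dKC xi xj _ li lj).
    by case/(xI _ _ iI' jI') => // eqij; rewrite eqij eqxx in nij'.
  move=> w wi; apply/negP => wj; move: nij'.
  by rewrite (dI i' j' iI' jI' w wi wj) eqxx.
have zz i' j' : i' \in I -> j' \in I -> i' != j' -> z i' != z j'.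
  move=> iI' jI'; apply: contraNneq => eqz; apply/eqP.
  by apply: (dI i' j' iI' jI' (z i')); rewrite ?eqz mem_rcons inE eqxx.
have zC i' : i' \in I -> z i' \in C.
  by move=> iI'; have [_ [_ _]] := hI i' iI'; rewrite inE.
apply: (no_tripod cC uC vC a2C a3C _ _ (ears i j iI jI nij) (ears j k jI kI njk)
  (ears k i kI iI nki)); by split; rewrite ?zC ?zz.
Qed.

End Ears.

(** * Three-connected graphs *)

(* A graph may live on a subset [V] of the ambient type, with the vertices
   outside [V] isolated.  [Z] may be larger than the boundary of [F]. *)
Definition cut (T : finType) (e : rel T) (V F Z : {set T}) :=
  [/\ F \subset V, [disjoint F & Z] & closed_up_to e F Z].

Definition connected3 (T : finType) (e : rel T) (V : {set T}) :=
  3 < #|V| /\ forall F Z x y, cut e V F Z -> x \in F -> y \in V -> y \notin F :|: Z ->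
    2 < #|Z|.

(** Equivalently, if at most three vertices separate [F] from the rest, then one of these two sides
    has at most one vertex. *)
Definition irreducible3 (T : finType) (e : rel T) (V : {set T}) :=
  forall F Z, cut e V F Z -> 1 < #|F| -> 1 < #|V :\: (F :|: Z)| -> 3 < #|Z|.

Section Connected.

Variables (T : finType) (e : rel T) (V : {set T}).
Hypothesis e_sym : symmetric e.
Hypothesis e_irr : irreflexive e.
Hypothesis eV : forall x y, e x y -> x \in V.
Hypothesis conn : connected3 e V.
Implicit Types (A B D F K X Z : {set T}) (a v x y z w : T) (C b p q s t : seq T).

Lemma eVr x y : e x y -> y \in V.
Proof. by rewrite e_sym; apply: eV. Qed.

(** Either the neighborhood of [x] separates it from some vertex, or [x] is adjacent to all of the
    at least three other vertices. *)
Lemma neighborsP x : x \in V -> exists a y z,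
  [/\ e x a, e x y & e x z] /\ [/\ a != y, y != z & z != a].
Proof.
move=> xV; have [cV hc] := conn.
suff /card_gt2P[a [y [z [h1 h2]]]] : 2 < #|nbhd e x|.
  by exists a, y, z; rewrite !inE in h1.
case: (pickP [pred y in V | y \notin [set x] :|: nbhd e x]) => [y /andP[yV yn]|h].
  apply: (hc [set x] _ x y _ _ yV yn); last by rewrite inE.
  split; first by rewrite sub1set.
    by apply/pred0P => w /=; rewrite !inE; case: eqP => // ->; rewrite e_irr.
  by move=> u w; rewrite !inE => /eqP-> ->; rewrite orbT.
rewrite -ltnS; apply: leq_trans cV _; have := cardsU1 x (nbhd e x).
rewrite inE e_irr add1n => <-; apply/subset_leq_card/subsetP => y yV.
by have := h y; rewrite /= yV => /negbFE.
Qed.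

Lemma closed_cut F Z : [disjoint F & Z] -> closed_up_to e F Z -> cut e V (F :&: V) Z.
Proof.
move=> dFZ cFZ; split; first exact: subsetIr.
  by apply: disjointWl dFZ; apply: subsetIl.
move=> x y; rewrite inE => /andP[xF xV] exy.
by have := cFZ x y xF exy; rewrite !inE (eVr exy) andbT.
Qed.

Lemma closed_card F Z x y : [disjoint F & Z] -> closed_up_to e F Z ->
  x \in F -> x \in V -> y \in V -> y \notin F -> y \notin Z -> 2 < #|Z|.
Proof.
move=> dFZ cFZ xF xV yV yF yZ; have [_ hc] := conn.
apply: (hc _ _ x y (closed_cut dFZ cFZ)); rewrite ?inE ?xF ?xV //.
by rewrite (negPf yF) (negPf yZ).
Qed.

(** Otherwise [X] and [D] together form a separator of at most two vertices between [a] and a vertex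
    of [B] outside [X]. *)
Lemma connected_fan a D B k : a \in V -> a \notin D -> a \notin B -> B \subset V ->
  [disjoint B & D] -> k + #|D| <= 3 -> k <= #|B| -> legs e [set a] D B k.
Proof.
move=> aV aD aB sBV dBD kD kB; case: (menger_fan e k aD aB) => // -[X [F [ltX aF dF cF]]].
have /subsetPn[y yB yX] : ~~ (B \subset X).
  by apply: contraL ltX => /subset_leq_card; rewrite -leqNgt; apply: leq_trans.
have : 2 < #|X :|: D|.
  apply: (closed_card (x := a) (y := y) _ cF) => //.
  - by apply: disjointWr dF; apply: subsetUl.
  - exact: (subsetP sBV).
  - by apply/negP => yF; have := disjointFr dF yF; rewrite !inE yB orbT.
  - by rewrite inE (negPf yX) (disjointFr dBD yB).
by move: (cardsU X D) ltX kD; count_lia.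
Qed.

(** Two disjoint paths from [x] to neighbors of [y] in G - v - y close up at [y]. If they are
    missing, [v] and at most one more vertex separate [x] from [y]. *)
Lemma cycle_through v x y : x \in V -> y \in V -> x != y -> v != x -> v != y ->
  ~~ e x y -> exists C, [/\ cycle e C, uniq C, v \notin C, x \in C & y \in C].
Proof.
move=> xV yV nxy nvx nvy exy; pose B := nbhd e y :\ v; pose D := [set v; y].
have xD : x \notin D by rewrite !inE negb_or eq_sym nvx nxy.
have xB : x \notin B by rewrite !inE e_sym (negPf exy) andbF.
case: (menger_fan e 2 xD xB) => [[X [F [ltX xF dF cF]]]|].
  have dXv : [disjoint F & v |: (X :\ y)].
    by apply: disjointWr dF; apply/subsetP => w; rewrite !inE;
      move=> /predU1P[->|/andP[_ ->]]; rewrite ?eqxx ?orbT.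
  have /(closed_card dXv) h : closed_up_to e F (v |: (X :\ y)).
    move=> u w uF euw; have := cF u w uF euw; rewrite !inE.
    have [wy|] := eqVneq w y; last first.
      by move=> _; case: (w == v); case: (w \in X); rewrite ?orbT ?orbF.
    have := disjointFr dF uF; rewrite !inE -wy (e_sym w) euw andbT.
    by case: (u == v); rewrite ?orbT.
  have : 2 < #|v |: (X :\ y)|.
    apply: (h x y) => //.
      by apply/negP => /(disjointFr dF); rewrite !inE eqxx !orbT.
    by rewrite !inE eqxx eq_sym (negPf nvy).
  by move: (cardsU1 v (X :\ y)) (cardsD1 y X) ltX; case: (_ \notin _) => /=; count_lia.
case=> I [u [b [z [cI hI dI xI]]]].
have /card_gt1P[i [j [iI jI nij]]] := cI.
have [/set1P ui [hb ub zB bB bD]] := hI i iI.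
have [/set1P uj [hb' ub' zB' bB' bD']] := hI j jI.
rewrite ui in hb; rewrite uj in hb'.
exists (x :: rcons (b i) (z i) ++ y :: rev (rcons (b j) (z j))); split.
- apply: cycle_of_paths => //; rewrite rcons_path last_rcons ?hb ?hb' /= e_sym.
    by move: zB; rewrite !inE => /andP[].
  by move: zB'; rewrite !inE => /andP[].
- apply/uniq_countP => w; move/uniq_countP/(_ w): ub; move/uniq_countP/(_ w): ub'.
  have /disj_countP/(_ w) : {in rcons (b i) (z i), forall w, w \notin rcons (b j) (z j)}.
    by move=> c ci; apply: contra nij => cj; apply/eqP/(dI i j iI jI c).
  have /disj_countP/(_ w) : {in rcons (b i) (z i), forall w, w \notin [:: x; y]}.
    by move=> c /bD; rewrite !inE orbCA => /norP[_].
  have /disj_countP/(_ w) : {in rcons (b j) (z j), forall w, w \notin [:: x; y]}.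
    by move=> c /bD'; rewrite !inE orbCA => /norP[_].
  have /uniq_countP/(_ w) : uniq [:: x; y] by rewrite /= inE nxy.
  by count_lia.
- rewrite inE mem_cat inE mem_rev !negb_or nvx nvy /=; apply/andP; split.
    by apply/negP => /bD; rewrite !inE eqxx orbT.
  by apply/negP => /bD'; rewrite !inE eqxx orbT.
- by rewrite inE eqxx.
by rewrite inE mem_cat inE eqxx !orbT.
Qed.

Lemma two_legs a D B : legs e [set a] D B 2 -> exists b z b' z',
  [/\ leg e (a |: D) B a b z, leg e (a |: D) B a b' z'
    & {in rcons b z, forall w, w \notin rcons b' z'}].
Proof.
case=> I [u [b [z [cI hI dI xI]]]].
have /card_gt1P[i [j [iI jI nij]]] := cI.
have [/set1P ui li] := hI i iI; have [/set1P uj lj] := hI j jI.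
rewrite ui in li; rewrite uj in lj; exists (b i), (z i), (b j), (z j); split=> //.
by move=> w wi; apply: contra nij => wj; apply/eqP/(dI i j iI jI w).
Qed.

(** A third neighbor [a] of [x] has a fan to [y] and [z] avoiding [x]; closed by the edge between
    [y] and [z], it is a cycle through three neighbors of [x]. *)
Lemma triangle_center x y z : e x y -> e y z -> e z x -> wheel_center e x.
Proof.
move=> exy eyz ezx; have exz : e x z by rewrite e_sym.
have neq u w : e u w -> u != w by apply: contraTneq => ->; rewrite e_irr.
have [a [exa /norP[ay az]]] : exists a, e x a /\ ~~ ((a == y) || (a == z)).
  have [p [q [r [[hp hq hr] [pq qr rp]]]]] := neighborsP (eV exy).
  have [|h] := boolP ((p == y) || (p == z)); last by exists p.
  have [|h'] := boolP ((q == y) || (q == z)); last by exists q.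
  move=> hq' hp'; exists r; split=> //; move: pq qr rp.
  by case/orP: hp' => /eqP->; case/orP: hq' => /eqP->; rewrite ?eqxx //;
    move=> _ h1 h2; rewrite negb_or h2 1?eq_sym h1.
have /two_legs[b [u [b' [u' [[hb ub uB bB bD] [hb' ub' uB' bB' bD'] dis]]]]] :
    legs e [set a] [set x] [set y; z] 2.
  apply: connected_fan; rewrite ?inE ?negb_or ?ay ?az ?(eVr exa) //.
  - by rewrite eq_sym neq.
  - by apply/subsetP => w; rewrite !inE => /orP[]/eqP->; [apply: eVr exy|apply: eVr exz].
  - apply/pred0P => w; rewrite /= !inE andbC; case: eqP => // ->.
    by rewrite (negPf (neq _ _ exy)) (negPf (neq _ _ exz)).
  - by rewrite cards1.
  - by rewrite cards2 neq.
have nuu' : u != u'.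
  apply/eqP => eq_u; have := dis u; rewrite -eq_u !mem_rcons !inE eqxx.
  by move=> /(_ isT).
have euu' : e u u'.
  move: uB uB' nuu'; rewrite !inE => /orP[]/eqP-> /orP[]/eqP->;
    by rewrite ?eqxx //= 1?e_sym.
have yzC c : c \in [:: y; z] -> c \in [:: u; u'].
  move: uB uB' nuu'; rewrite !inE => /orP[]/eqP-> /orP[]/eqP->;
    by rewrite ?eqxx //= 1?orbC.
pose C := a :: rcons b u ++ u' :: rev b'.
have uC : uniq C.
  apply/uniq_countP => w; move/uniq_countP/(_ w): ub; move/uniq_countP/(_ w): ub'.
  have /disj_countP/(_ w) : {in rcons b u, forall w, w \notin [:: a]}.
    by move=> c /bD; rewrite !inE => /norP[].
  have /disj_countP/(_ w) : {in rcons b' u', forall w, w \notin [:: a]}.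
    by move=> c /bD'; rewrite !inE => /norP[].
  move/disj_countP/(_ w): dis; have /uniq_countP/(_ w) : uniq [:: a] by [].
  by rewrite /C; count_lia.
apply: (@wheelI _ e C x a y z) => //.
- by apply: cycle_of_paths => //; rewrite rcons_path hb last_rcons.
- rewrite !inE mem_cat inE mem_rev !negb_or neq //=; apply/and3P; split.
  + by apply/negP => /bD; rewrite !inE eqxx orbT.
  + by move: uB'; rewrite !inE => /orP[]/eqP->; rewrite neq.
  + by apply/negP => xb; have := bD' x; rewrite mem_rcons inE xb !inE eqxx !orbT => /(_ isT).
- have hC c : c \in [:: u; u'] -> c \in C.
    rewrite !inE mem_cat mem_rcons !inE => /orP[]->; rewrite ?orbT //.
  by split; rewrite ?inE ?eqxx //; apply/hC/yzC; rewrite !inE eqxx ?orbT.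
- by rewrite ay neq // eq_sym az.
Qed.

Hypothesis irr : irreducible3 e V.

(** [X] and [v] are at most three vertices, and at least two of the four or more vertices of [B]
    remain on the far side, so [F] has no room for two. *)
Lemma irreducible_side v B X F : B \subset V -> v \notin B -> 3 < #|B| -> #|X| < 3 ->
  [disjoint F & X :|: [set v] :|: B] -> closed_up_to e F (X :|: [set v]) ->
  #|F :&: V| <= 1.
Proof.
move=> sBV vB cB cX dF cF; rewrite leqNgt; apply/negP => lt1.
have dFZ : [disjoint F & X :|: [set v]] by apply: disjointWr dF; apply: subsetUl.
have : 3 < #|X :|: [set v]|.
  apply: (irr (closed_cut dFZ cF) lt1).
  have : 1 < #|B :\: X|.
    by move: (cardsID X B) (subset_leq_card (subsetIr B X)) cB cX; count_lia.
  move=> h; apply: leq_trans h _; apply/subset_leq_card/subsetP => w.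
  rewrite !inE => /andP[wX wB]; rewrite (subsetP sBV) // (negPf wX) andbT /=.
  rewrite negb_or; apply/andP; split; last by apply: contraNneq vB => <-.
  by apply/negP => /andP[wF _]; have := disjointFr dF wF; rewrite !inE wB orbT.
by move: (cardsU X [set v]) cX; rewrite cards1; count_lia.
Qed.

(** Without a fan, [a] is alone on its side, so its four or more neighbors all lie among [v] and the
    at most two vertices of [X]. *)
Lemma irreducible_fan a v B : a \in V -> 3 < degree e a -> a != v -> a \notin B ->
  B \subset V -> v \notin B -> 3 < #|B| -> legs e [set a] [set v] B 3.
Proof.
move=> aV da av aB sBV vB cB.
have aD : a \notin [set v] by rewrite inE.
case: (menger_fan e 3 aD aB) => // -[X [F [ltX aF dF cF]]].
have /card_le1P/(_ a) F1 := irreducible_side sBV vB cB ltX dF cF.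
have : degree e a <= #|X :|: [set v]|.
  apply/subset_leq_card/subsetP => w; rewrite inE => eaw.
  have := cF a w aF eaw; rewrite inE => /orP[wF|//].
  have := F1 _ w; rewrite !inE aF aV wF (eVr eaw) => /(_ isT)/esym/eqP wa.
  by rewrite wa e_irr in eaw.
by move: da (cardsU X [set v]) ltX; rewrite cards1; count_lia.
Qed.

(** At least two of the four or more vertices of [K] are outside [X], too many for the side [F]. *)
Lemma irreducible_link K v B : K \subset V -> 3 < #|K| -> v \notin K ->
  [disjoint K & B] -> B \subset V -> v \notin B -> 3 < #|B| -> legs e K [set v] B 3.
Proof.
move=> sKV cK vK dKB sBV vB cB.
have dKv : [disjoint K & [set v]] by rewrite disjoint_sym disjoints1.
case: (menger_legs e 3 dKB dKv) => // -[X [F [ltX KF dF cF]]].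
have := irreducible_side sBV vB cB ltX dF cF.
have : #|K :\: X| <= #|F :&: V|.
  apply/subset_leq_card/subsetP => w; rewrite !inE => /andP[wX wK].
  by rewrite (subsetP sKV) // andbT; have := subsetP KF w wK; rewrite inE (negPf wX) orbF.
by move: (cardsID X K) (subset_leq_card (subsetIr K X)) ltX cK; count_lia.
Qed.

Hypothesis triangle_free : forall x y z, e x y -> e y z -> ~~ e z x.

Lemma cycle_size C : cycle e C -> uniq C -> 2 < size C -> 3 < size C.
Proof.
case: C => [|x [|y [|z [|w C]]]] //= /and4P[exy eyz ezx _].
by move: (triangle_free exy eyz); rewrite ezx.
Qed.

Lemma cycle_sub C : cycle e C -> [set w in C] \subset V.
Proof.
by move=> cC; apply/subsetP => w; rewrite inE => /(next_cycle cC)/eV.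
Qed.

End Connected.

(** * Graphs whose 3-cuts isolate a vertex *)

Section Irreducible.

Variables (T : finType) (e : rel T) (V : {set T}).
Hypothesis e_sym : symmetric e.
Hypothesis e_irr : irreflexive e.
Hypothesis eV : forall x y, e x y -> x \in V.
Hypothesis conn : connected3 e V.
Hypothesis irr : irreducible3 e V.
Hypothesis triangle_free : forall x y z, e x y -> e y z -> ~~ e z x.
Implicit Types (A B D F X Z : {set T}) (a v x y z w : T) (C K p q s t : seq T).

Lemma two_other_neighbors v a : e v a -> exists x y,
  [/\ e v x, e v y & [/\ a != x, x != y & y != a]].
Proof.
move=> eva; have [p [q [r [[ep eq er] [pq qr rp]]]]] := neighborsP e_irr conn (eV eva).
have [->|ap] := eqVneq a p; first by exists q, r.
have [->|aq] := eqVneq a q; first by exists r, p.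
by exists p, q; split=> //; split=> //; rewrite eq_sym.
Qed.

Lemma adj_neq x y : e x y -> x != y.
Proof. by apply: contraTneq => ->; rewrite e_irr. Qed.

Lemma cycle_through_neighbors v x y : e v x -> e v y -> x != y ->
  exists C, [/\ cycle e C, uniq C, v \notin C, x \in C & y \in C].
Proof.
move=> evx evy nxy; apply: (cycle_through e_sym eV conn) => //; try exact: adj_neq.
- exact: eVr evx.
- exact: eVr evy.
by apply: (@triangle_free y v x); rewrite // e_sym.
Qed.

Lemma cycle_card C x y : cycle e C -> uniq C -> x \in C -> y \in C -> x != y ->
  ~~ e x y -> 3 < #|[set w in C]|.
Proof.
move=> cC uC xC yC nxy exy; rewrite cardsE (card_uniqP uC).
apply: (cycle_size triangle_free cC uC).
case: C cC uC xC yC => [|a [|b [|]]] //=; rewrite ?inE.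
  by move=> _ _ /eqP ax /eqP ay; rewrite ax ay eqxx in nxy.
move=> /and3P[eab eba _] _ /orP[]/eqP ax /orP[]/eqP ay; move: nxy exy;
  by rewrite ax ay ?eqxx ?eab ?eba.
Qed.

(** If [a] had a fourth neighbor, it would have a fan of three paths in G - v to a cycle through two
    other neighbors of [v], against [no_three_legs]. *)
Lemma neighbor_of_noncenter_cubic v a : e v a -> ~ wheel_center e v -> degree e a = 3.
Proof.
move=> eva nv; have [x [y [evx evy neq]]] := two_other_neighbors eva.
have [ax nxy ya] := neq.
have [C [cC uC vC xC yC]] := cycle_through_neighbors evx evy nxy.
have exy : ~~ e x y by apply: (@triangle_free y v x); rewrite // e_sym.
have aV := eVr e_sym eV eva.
have aC : a \notin C.
  by apply/negP => aC; apply: (no_wheel nv (And3 eva evx evy) neq cC uC vC).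
apply/eqP; rewrite eqn_leq andbC; apply/andP; split.
  have [p [q [r [[ep eq er] pqr]]]] := neighborsP e_irr conn aV.
  by apply/card_gt2P; exists p, q, r; rewrite !inE ep eq er.
rewrite leqNgt; apply/negP => da.
apply: (no_three_legs e_sym nv (And3 eva evx evy) neq _ _ _ cC uC vC xC yC).
- exact: joined_through_set1.
- by rewrite inE adj_neq.
- by rewrite disjoints1 inE aC.
apply: (irreducible_fan e_sym e_irr eV irr aV da); rewrite ?inE //.
- by rewrite eq_sym adj_neq.
- exact: (cycle_sub eV).
exact: (cycle_card cC uC xC yC nxy exy).
Qed.

(** Both cycles have at least four vertices, so three disjoint paths link them in G - v, against
    [no_three_legs]. *)
Lemma no_disjoint_cycles v a1 a2 a3 K C : ~ wheel_center e v ->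
  [/\ e v a1, e v a2 & e v a3] -> [/\ a1 != a2, a2 != a3 & a3 != a1] ->
  cycle e K -> uniq K -> 2 < size K -> a1 \in K -> v \notin K ->
  cycle e C -> uniq C -> a2 \in C -> a3 \in C -> v \notin C ->
  {in K, forall w, w \notin C} -> False.
Proof.
move=> nv ev neq cK uK sK aK vK cC uC a2C a3C vC dKC.
have dKC' : [disjoint [set w in K] & [set w in C]].
  by apply/pred0P => w; rewrite /= !inE; apply/negP => /andP[/dKC/negP].
have [ev1 ev2 ev3] := ev; have [n12 n23 n31] := neq.
apply: (no_three_legs e_sym nv ev neq _ _ dKC' cC uC vC a2C a3C).
- by apply: joined_through_cycle => //; apply: ltnW.
- by rewrite inE.
apply: (irreducible_link e_sym eV irr) => //; rewrite ?inE //.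
- exact: (cycle_sub eV).
- by rewrite cardsE (card_uniqP uK); apply: (cycle_size triangle_free).
- exact: (cycle_sub eV).
apply: (cycle_card cC uC a2C a3C n23).
by apply: (@triangle_free a3 v a2); rewrite // e_sym.
Qed.

(** * Theta subgraphs around a non-center *)

Variable v : T.
Hypothesis v_nocenter : ~ wheel_center e v.

(** A branch [(L, a, R)] is the interior of a path of the theta, split at a marked neighbor [a] of
    [v]. *)
Definition verts (b : seq T * T * seq T) := b.1.1 ++ b.1.2 :: b.2.

Definition theta z z' b1 b2 b3 :=
  [/\ [/\ path e z (rcons (verts b1) z'), path e z (rcons (verts b2) z')
        & path e z (rcons (verts b3) z')],
      uniq (v :: z :: z' :: verts b1 ++ verts b2 ++ verts b3)
    & [/\ e v b1.1.2, e v b2.1.2 & e v b3.1.2]].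

Lemma theta_swap12 z z' b1 b2 b3 : theta z z' b1 b2 b3 -> theta z z' b2 b1 b3.
Proof.
case=> [[p1 p2 p3] u [e1 e2 e3]]; split=> //.
apply/uniq_countP => w; move/uniq_countP/(_ w): u.
by count_lia.
Qed.

Lemma theta_swap23 z z' b1 b2 b3 : theta z z' b1 b2 b3 -> theta z z' b1 b3 b2.
Proof.
case=> [[p1 p2 p3] u [e1 e2 e3]]; split=> //.
apply/uniq_countP => w; move/uniq_countP/(_ w): u.
by count_lia.
Qed.

Definition rev_branch (b : seq T * T * seq T) := (rev b.2, b.1.2, rev b.1.1).

Lemma verts_rev b : verts (rev_branch b) = rev (verts b).
Proof. by rewrite /verts rev_cat rev_cons cat_rcons. Qed.

Lemma theta_rev z z' b1 b2 b3 : theta z z' b1 b2 b3 ->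
  theta z' z (rev_branch b1) (rev_branch b2) (rev_branch b3).
Proof.
case=> [[p1 p2 p3] u ev]; split=> //.
  by rewrite !verts_rev -!(path_rcons_rev e_sym).
apply/uniq_countP => w; move/uniq_countP/(_ w): u.
by rewrite !verts_rev /= !countE /=; count_lia.
Qed.

Lemma theta_neq z z' b1 b2 b3 : theta z z' b1 b2 b3 ->
  [/\ b1.1.2 != b2.1.2, b2.1.2 != b3.1.2 & b3.1.2 != b1.1.2].
Proof.
case=> _ /uniq_countP u _; split; apply/eqP => eqa.
- by have := u b2.1.2; rewrite /verts /= !countE /= eqa eqxx /=; count_lia.
- by have := u b3.1.2; rewrite /verts /= !countE /= eqa eqxx /=; count_lia.
- by have := u b1.1.2; rewrite /verts /= !countE /= eqa eqxx /=; count_lia.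
Qed.

(** Splits a path at an inner vertex, which then closes the first half and opens the second. *)
Lemma path_mid x s y t z :
  path e x (rcons (s ++ y :: t) z) = path e x (rcons s y) && path e y (rcons t z).
Proof. by rewrite rcons_cat rcons_cons -cat_rcons cat_path last_rcons. Qed.

Lemma theta_no_crossing z z' b1 b2 b3 x y (w : seq T) : theta z z' b1 b2 b3 ->
  x \in b1.1.1 -> y \in b2.2 -> path e x (rcons w y) -> uniq w ->
  {in w, forall u, u \notin v :: z :: z' :: verts b1 ++ verts b2 ++ verts b3} -> False.
Proof.
move=> th; have := th; case: b1 b2 b3 th => [[L1 a1] R1] [[L2 a2] R2] [[L3 a3] R3] th.
rewrite /theta /verts => -[[p1 p2 p3] u ev] xL yR hw uw dw.
rewrite /= in p1 p2 p3 ev xL yR.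
have /= neq := theta_neq th; rewrite /verts in dw.
case/splitPr: xL p1 u dw {th} => l1 l2 p1 u dw.
case/splitPr: yR p2 u dw => r1 r2 p2 u dw.
move: p1; rewrite -catA cat_cons path_mid => /andP[_ px].
move: p2; rewrite -cat_cons catA path_mid => /andP[py _].
pose s := (l2 ++ a1 :: R1) ++ z' :: rev (L3 ++ a3 :: R3) ++ z :: (L2 ++ a2 :: r1).
have hs : path e x (rcons s y).
  rewrite /s path_mid px path_mid -(path_rcons_rev e_sym) p3; exact: py.
apply: (no_wheel v_nocenter ev neq (cycle_of_paths e_sym hs hw)).
- apply/uniq_countP => c; move/uniq_countP/(_ c): u; move/uniq_countP/(_ c): uw.
  by move/disj_countP/(_ c): dw; rewrite /s; count_lia.
- have vw : v \notin w by apply/negP => /dw; rewrite inE eqxx.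
  move/uniq_countP/(_ v): u; move: vw.
  by rewrite /s !mem_count /= !countE /= !countE /= eqxx /=; count_lia.
- by rewrite /s inE !(mem_cat, inE) eqxx !orbT.
- by rewrite /s inE !(mem_cat, inE) eqxx !orbT.
by rewrite /s inE !(mem_cat, inE, mem_rev) eqxx !orbT.
Qed.

(** The path [w] closes a cycle with the piece of the first branch around its marked vertex; the
    other two branches form a disjoint cycle. *)
Lemma theta_no_shortcut z z' b1 b2 b3 x y (w : seq T) : theta z z' b1 b2 b3 ->
  x \in b1.1.1 -> y \in b1.2 -> path e x (rcons w y) -> uniq w ->
  {in w, forall u, u \notin v :: z :: z' :: verts b1 ++ verts b2 ++ verts b3} -> False.
Proof.
move=> th; have := th; case: b1 b2 b3 th => [[L1 a1] R1] [[L2 a2] R2] [[L3 a3] R3] th.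
rewrite /theta /verts => -[[p1 p2 p3] u ev] xL yR hw uw dw.
rewrite /= in p1 p2 p3 ev xL yR.
have /= neq := theta_neq th; rewrite /verts in dw.
case/splitPr: xL p1 u dw {th} => l1 l2 p1 u dw.
case/splitPr: yR p1 u dw => r1 r2 p1 u dw.
move: p1; rewrite -catA cat_cons path_mid => /andP[_].
rewrite -cat_cons catA path_mid => /andP[hs _].
pose K := x :: (l2 ++ a1 :: r1) ++ y :: rev w.
pose C := z :: (L2 ++ a2 :: R2) ++ z' :: rev (L3 ++ a3 :: R3).
apply: (@no_disjoint_cycles v a1 a2 a3 K C) => //.
- exact: (cycle_of_paths e_sym hs hw).
- apply/uniq_countP => c; move/uniq_countP/(_ c): u; move/uniq_countP/(_ c): uw.
  by move/disj_countP/(_ c): dw; rewrite /K; count_lia.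
- by rewrite /K /= !size_cat /=; lia.
- by rewrite /K inE !(mem_cat, inE) eqxx !orbT.
- have vw : v \notin w by apply/negP => /dw; rewrite inE eqxx.
  move/uniq_countP/(_ v): u; move: vw.
  by rewrite /K !mem_count /= !countE /= eqxx /=; count_lia.
- exact: (cycle_of_paths e_sym p2 p3).
- apply/uniq_countP => c; move/uniq_countP/(_ c): u.
  by rewrite /C; count_lia.
- by rewrite /C inE !(mem_cat, inE) eqxx !orbT.
- by rewrite /C inE !(mem_cat, inE, mem_rev) eqxx !orbT.
- move/uniq_countP/(_ v): u.
  by rewrite /C !mem_count /= !countE /= eqxx /=; count_lia.
apply/disj_countP => c; move/uniq_countP/(_ c): u.
by move/disj_countP/(_ c): dw; rewrite /C /K /= !countE /=; count_lia.
Qed.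

(** Two paths from [a1] to a cycle through [a2] and [a3] form an ear. By [ear_arc], applied to both
    arcs between its ends, each arc contains one of [a2] and [a3]. *)
Lemma theta_exists a1 a2 a3 : [/\ e v a1, e v a2 & e v a3] ->
  [/\ a1 != a2, a2 != a3 & a3 != a1] ->
  exists z z' b1 b2 b3, theta z z' b1 b2 b3.
Proof.
move=> ev neq; have [ev1 ev2 ev3] := ev; have [n12 n23 n31] := neq.
have [C [cC uC vC a2C a3C]] := cycle_through_neighbors ev2 ev3 n23.
have e23 : ~~ e a2 a3 by apply: (@triangle_free a3 v a2); rewrite // e_sym.
have cardC := cycle_card cC uC a2C a3C n23 e23.
have a1C : a1 \notin C by apply/negP => a1C; apply: (no_wheel v_nocenter ev neq cC uC vC).
have nva := adj_neq ev1.
have /two_legs[b [z [b' [z' [l1 l2 dis]]]]] : legs e [set a1] [set v] [set w in C] 2.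
  apply: (connected_fan e_sym eV conn); rewrite ?inE ?cards1 //.
  - exact: eVr ev1.
  - by rewrite eq_sym.
  - exact: (cycle_sub eV).
  - by rewrite disjoint_sym disjoints1 inE.
  - by apply: leq_trans cardC.
have zz' : ear e v a1 C z z'.
  apply: (legs_ear e_sym (@joined_through_set1 _ e a1) _ _ _ _ _ l1 l2 dis) => //;
    rewrite ?inE ?disjoints1 ?inE //.
have [_ _ zC _ _] := l1; have [_ _ zC' _ _] := l2; rewrite !inE in zC zC'.
have nzz' : z != z'.
  apply/eqP => eqz; have := dis z; rewrite -eqz !mem_rcons !inE eqxx.
  by move=> /(_ isT).
have [P [Q [cC' uC' eqC]]] := split_cycle cC uC zC zC' nzz'.
have hP : (a2 \in P) || (a3 \in P).
  apply: (ear_arc v_nocenter ev neq cC' uC'); rewrite ?eqC //.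
  by apply: ear_eq zz' => w; rewrite eqC.
have eqr : rot (size (z :: P)) (z :: P ++ z' :: Q) = z' :: Q ++ z :: P.
  by rewrite -cat_cons rot_size_cat.
have hQ : (a2 \in Q) || (a3 \in Q).
  apply: (@ear_arc _ e v a1 a2 a3 v_nocenter ev neq z' Q z P);
    rewrite -?eqr ?rot_cycle ?rot_uniq ?mem_rot ?eqC //.
  by apply: ear_eq (ear_sym e_sym zz') => w; rewrite mem_rot eqC.
have [q [hq uq a1q vq qC]] := zz'; rewrite -eqC in vC.
have {}qC : {in q, forall w, w \notin z :: P ++ z' :: Q}.
  by move=> w /qC; rewrite eqC.
move: cC'; rewrite /= rcons_cat rcons_cons -cat_rcons cat_path last_rcons => /andP[hP' hQ'].
case/splitPr: a1q hq uq vq qC => L1 R1 hq uq vq qC.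
have uPQ x y : x \in P -> x \in Q -> False.
  by move/uniq_countP/(_ x): uC'; rewrite !mem_count /= !countE /=; count_lia.
wlog [a2P a3Q] : a2 a3 ev neq ev2 ev3 n12 n23 n31 a2C a3C e23 hP hQ / a2 \in P /\ a3 \in Q.
  move=> hw; case/orP: (hP) => hP2; case/orP: (hQ) => hQ2.
  - by case: (uPQ a2 a2).
  - by apply: (hw a2 a3).
  - apply: (hw a3 a2) => //; rewrite 1?orbC 1?e_sym // 1?eq_sym //.
    by split; rewrite // eq_sym.
  - by case: (uPQ a3 a3).
case/splitPr: a2P hP' uC' vC qC {eqC hP hQ eqr uPQ} => L2 R2 hP' uC' vC qC.
case/splitPr: a3Q hQ' uC' vC qC => L3 R3 hQ' uC' vC qC.
(* The arc [Q] runs from [z'] back to [z], so its branch is reversed. *)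
exists z, z', (L1, a1, R1), (L2, a2, R2), (rev R3, a3, rev L3).
split=> //; rewrite /verts.
  by split; rewrite //= -cat_rcons -rev_cons -rev_cat -(path_rcons_rev e_sym).
apply/uniq_countP => w; move/uniq_countP/(_ w): uC'; move/uniq_countP/(_ w): uq.
have /uniq_countP/(_ w) : uniq [:: v] by [].
have /disj_countP/(_ w) : {in [:: v], forall c, c \notin L1 ++ a1 :: R1}.
  by move=> c; rewrite inE => /eqP->.
have /disj_countP/(_ w) : 
    {in [:: v], forall c, c \notin z :: (L2 ++ a2 :: R2) ++ z' :: L3 ++ a3 :: R3}.
  by move=> c; rewrite inE => /eqP->.
by move/disj_countP/(_ w): qC; count_lia.
Qed.

Hypothesis cubic : forall u, u \in V -> degree e u = 3.

Lemma cubic_nbhd u x y z : e u x -> e u y -> e u z -> x != y -> y != z -> z != x ->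
  nbhd e u = [set x; y; z].
Proof.
move=> ex ey ez xy yz zx; apply/esym/eqP; rewrite eqEcard; apply/andP; split.
  by apply/subsetP => w; rewrite !inE => /orP[/orP[]|] /eqP->.
have -> : #|nbhd e u| = 3 by apply: cubic (eV ex).
by rewrite -setUA cardsU1 cards2 yz !inE negb_or xy eq_sym zx.
Qed.

(** The three branches use up all edges at the cubic vertex [z]: its neighbors are their first
    vertices. *)
Lemma theta_start z z' b1 b2 b3 w : theta z z' b1 b2 b3 -> e z w ->
  [|| w \in b1.1.1 ++ [:: b1.1.2], w \in b2.1.1 ++ [:: b2.1.2]
    | w \in b3.1.1 ++ [:: b3.1.2]].
Proof.
pose hd (b : seq T * T * seq T) := head b.1.2 b.1.1.
have hd_in b : hd b \in b.1.1 ++ [:: b.1.2].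
  by case: b => [[[|x L] a] R] /=; rewrite !inE eqxx.
have sub (b : seq T * T * seq T) x : x \in b.1.1 ++ [:: b.1.2] -> x \in verts b.
  by rewrite /verts; count_lia.
have e_hd b : path e z (rcons (verts b) z') -> e z (hd b).
  by case: b => [[[|x L] a] R] /= /andP[].
case=> [[/e_hd h1 /e_hd h2 /e_hd h3] u _].
have hd_count b : 0 < count_mem (hd b) (verts b) by rewrite -mem_count sub.
have n12 : hd b1 != hd b2.
  apply/eqP => eqh; move: (hd_count b1) (hd_count b2).
  by move/uniq_countP/(_ (hd b2)): u; rewrite eqh; count_lia.
have n23 : hd b2 != hd b3.
  apply/eqP => eqh; move: (hd_count b2) (hd_count b3).
  by move/uniq_countP/(_ (hd b3)): u; rewrite eqh; count_lia.
have n31 : hd b3 != hd b1.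
  apply/eqP => eqh; move: (hd_count b3) (hd_count b1).
  by move/uniq_countP/(_ (hd b1)): u; rewrite eqh; count_lia.
have /setP/(_ w) := cubic_nbhd h1 h2 h3 n12 n23 n31.
rewrite [in LHS]inE => -> ; rewrite !inE -orbA.
by case/or3P => /eqP->; rewrite hd_in ?orbT.
Qed.

(** A connecting path contains one from the [z]-half [A] to the [z']-half [B] of the theta with its
    interior off the theta. Its ends lie on the same branch, a shortcut, or on two branches, a
    crossing. *)
Lemma theta_separated z z' b1 b2 b3 : theta z z' b1 b2 b3 ->
  ~~ connect (del_rel e [set v; b1.1.2; b2.1.2; b3.1.2]) z z'.
Proof.
move=> th; have [_ /uniq_countP u _] := th; set S := [set _; _; _; _].
pose A := z :: b1.1.1 ++ b2.1.1 ++ b3.1.1; pose B := z' :: b1.2 ++ b2.2 ++ b3.2.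
have memS c : (c \in S) = (c \in [:: v; b1.1.2; b2.1.2; b3.1.2]).
  by rewrite !inE -!orbA.
apply/negP => /connectP[p0 hp0 lp0].
have [p [hp lp up]] : exists p, [/\ path (del_rel e S) z p, z' = last z p & uniq (z :: p)].
  by case/shortenP: hp0 lp0 => p hp up _ lp; exists p.
have : abpath (del_rel e S) [set c in A] [set c in B] (z :: p).
  by apply/and4P; split; rewrite // -?lp !inE eqxx.
case/trim_abpath => x [q [_ /del_rel_path[hq qS] uq [xA lB qA qB]]].
rewrite inE in xA; rewrite inE in lB.
case/lastP: q hq qS uq lB qA qB => [|w y] hq qS uq lB qA qB.
  by move: xA lB (u x); rewrite /= /A /B /verts; count_lia.
rewrite last_rcons in lB; rewrite belast_rcons in qB.
have wAB c : c \in w -> c \notin v :: z :: z' :: verts b1 ++ verts b2 ++ verts b3.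
  move=> cw; have cq : c \in rcons w y by rewrite mem_rcons inE cw orbT.
  have cb : c \in x :: w by rewrite inE cw orbT.
  move: (qA c cq) (qS c cq) (qB c cb); rewrite memS.
  rewrite [c \in [set _ in A]]inE [c \in [set _ in B]]inE /A /B /verts; count_lia.
have uw : uniq w by move: uq; rewrite /= rcons_uniq => /and3P[].
have memS' c : c \in rcons w y -> c \notin A /\ c \notin S.
  by move=> cw; have := qA c cw; rewrite inE => ->; rewrite qS.
(* The vertex after [z] would be a neighbor of [z], hence in [A] or marked, and the path avoids
   both. The end [z'] is excluded likewise on the reversed theta. *)
have xz : x != z.
  apply/eqP => xz; rewrite xz in hq.
  have [c ezc cw] : exists2 c, e z c & c \in rcons w y.
    by case: (w) hq => [|c w'] /= /andP[ezc _]; [exists y|exists c]; rewrite ?inE ?eqxx.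
  have := theta_start th ezc; have [] := memS' c cw; rewrite memS /A.
  by rewrite !mem_count; count_lia.
have yz' : y != z'.
  apply/eqP => yz; rewrite yz in hq.
  have [c ecz cw] : exists2 c, e z' c & c \in x :: w.
    by move: hq; rewrite rcons_path => /andP[_ h]; exists (last x w); rewrite ?mem_last // e_sym.
  have := theta_start (theta_rev th) ecz; rewrite /= !mem_cat !mem_rev.
  have [xc|cw'] : c = x \/ c \in w by move: cw; rewrite inE => /orP[/eqP|]; [left|right].
    rewrite xc; move: xA (u x); rewrite /A /verts !mem_count; count_lia.
  by have := wAB c cw'; rewrite /verts !mem_count; count_lia.
have {}xA : [\/ x \in b1.1.1, x \in b2.1.1 | x \in b3.1.1].
  by move: xA; rewrite inE (negPf xz) /= !mem_cat => /or3P.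
have {}yB : [\/ y \in b1.2, y \in b2.2 | y \in b3.2].
  by move: lB; rewrite inE (negPf yz') /= !mem_cat => /or3P.
have perm_disj b b' b'' : verts b ++ verts b' ++ verts b'' =i verts b1 ++ verts b2 ++ verts b3 ->
    {in w, forall c, c \notin v :: z :: z' :: verts b ++ verts b' ++ verts b''}.
  by move=> eqb c /wAB; rewrite !inE eqb.
have th21 := theta_swap12 th; have th13 := theta_swap23 th.
have th23 := theta_swap23 th21; have th31 := theta_swap12 th13.
have th32 := theta_swap12 (theta_swap23 th21).
case: xA => xA; case: yB => yB.
- by apply: (theta_no_shortcut th xA yB hq uw wAB).
- by apply: (theta_no_crossing th xA yB hq uw wAB).
- apply: (theta_no_crossing th13 xA yB hq uw).
  by apply: perm_disj => c; rewrite !mem_cat; do !case: (_ \in _).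
- apply: (theta_no_crossing th21 xA yB hq uw).
  by apply: perm_disj => c; rewrite !mem_cat; do !case: (_ \in _).
- apply: (theta_no_shortcut th21 xA yB hq uw).
  by apply: perm_disj => c; rewrite !mem_cat; do !case: (_ \in _).
- apply: (theta_no_crossing th23 xA yB hq uw).
  by apply: perm_disj => c; rewrite !mem_cat; do !case: (_ \in _).
- apply: (theta_no_crossing th31 xA yB hq uw).
  by apply: perm_disj => c; rewrite !mem_cat; do !case: (_ \in _).
- apply: (theta_no_crossing th32 xA yB hq uw).
  by apply: perm_disj => c; rewrite !mem_cat; do !case: (_ \in _).
- apply: (theta_no_shortcut th31 xA yB hq uw).
  by apply: perm_disj => c; rewrite !mem_cat; do !case: (_ \in _).
Qed.

Lemma cubic_degree u x : e u x -> #|nbhd e u| = 3.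
Proof. by move=> eux; apply: cubic (eV eux). Qed.

(** The three marked vertices [A] separate [v], the component [F] of [z] and the rest [G], which
    contains [z']. Each of [F] and [G] leaves two vertices on its far side, so both are single and
    the graph is K_{3,3}. *)
Lemma theta_K33 z z' b1 b2 b3 : theta z z' b1 b2 b3 ->
  #|V| = 6 /\ exists u w x y : T,
    [/\ twins e u w, twins e x y & [disjoint [set u; w] & [set x; y]]].
Proof.
move=> th; have sep := theta_separated th; have [[p1 p2 p3] u [ev1 ev2 ev3]] := th.
have [n12 n23 n31] := theta_neq th.
move: sep ev1 ev2 ev3 n12 n23 n31.
have vz_notin : [/\ v != z, v != z', z != z', z \notin [set b1.1.2; b2.1.2; b3.1.2]
    & z' \notin [set b1.1.2; b2.1.2; b3.1.2]].
  move: u => /= /and4P[]; rewrite !inE !negb_or => /and3P[-> -> _] /andP[-> hz] hz' _.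
  move: hz hz'; rewrite /verts !mem_cat !inE !negb_or -!andbA.
  by case/and5P => _ -> _ _ /and5P[-> _ _ -> _] /and5P[_ -> _ _ /and5P[-> _ _ -> _]].
set a1 := b1.1.2 in vz_notin *; set a2 := b2.1.2 in vz_notin *.
set a3 := b3.1.2 in vz_notin *.
have zV : z \in V by case: (verts b1) p1 => [|? ?] /= /andP[/eV].
have z'V : z' \in V.
  by move: p1; rewrite (path_rcons_rev e_sym); case: (rev _) => [|? ?] /= /andP[/eV].
move: vz_notin => [nvz nvz' nzz' zA z'A] sep ev1 ev2 ev3 n12 n23 n31.
set A := [set a1; a2; a3] in zA z'A *.
have Nv : nbhd e v = A by apply: cubic_nbhd.
have cA : #|A| = 3 by rewrite -Nv; apply: cubic_degree ev1.
have vA : v \notin A by rewrite -Nv inE e_irr.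
have defS : [set v; a1; a2; a3] = v |: A by rewrite /A !setUA.
rewrite defS in sep.
have a1A : a1 \in A by rewrite !inE eqxx.
have a2A : a2 \in A by rewrite !inE eqxx orbT.
clearbody A.
pose F := [set w in V | connect (del_rel e (v |: A)) z w].
have zF : z \in F by rewrite inE zV connect0.
have FS w : w \in F -> w \notin v |: A.
  rewrite inE => /andP[_ /del_rel_connect_notin]; apply.
  by rewrite !in_setU1 negb_or eq_sym nvz.
have dFA : [disjoint F & A].
  by apply/pred0P => w /=; apply/negP => /andP[/FS]; rewrite in_setU1 => /norP[_ /negPf->].
have cF : closed_up_to e F A.
  move=> x y xF exy; rewrite inE; case: (boolP (y \in A)) => [_|yA]; first by rewrite orbT.
  have yv : y != v.
    by apply/eqP => yv; have := FS x xF; rewrite in_setU1 -Nv inE -yv e_sym exy orbT.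
  have := xF; rewrite !inE => /andP[_ zx]; rewrite (eVr e_sym eV exy) orbF /=.
  apply: connect_trans zx (connect1 _).
  by rewrite /del_rel /= (FS x xF) in_setU1 (negPf yv) (negPf yA).
pose G := V :\: (F :|: A) :\ v.
have z'G : z' \in G by rewrite !inE eq_sym nvz' z'V (negPf sep) (negPf z'A).
have vV : v \in V := eV ev1.
have vF : v \notin F by apply/negP => /FS; rewrite setU11.
have dGA : [disjoint G & A].
  by apply/pred0P => w /=; rewrite !in_setD in_setU; case: (w \in A); rewrite ?orbT ?andbF.
have cG : closed_up_to e G A.
  move=> x y; rewrite !in_setD !in_setU in_set1 negb_or => /and3P[xv /andP[xF xA] xV] exy.
  have yv : y != v by apply: contraNneq xA => yv; rewrite -Nv inE -yv e_sym.
  case: (boolP (y \in A)) => [_|yA]; first by rewrite orbT.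
  rewrite orbF /G !in_setD in_set1 yv in_setU (negPf yA) orbF (eVr e_sym eV exy) andbT /=.
  apply: contra xF => yF; have := cF y x yF; rewrite e_sym => /(_ exy).
  by rewrite inE (negPf xA) orbF.
have single H x : cut e V H A -> x \in H -> 1 < #|V :\: (H :|: A)| -> H = [set x].
  move=> cH xH rest; apply/eqP; rewrite eq_sym eqEcard sub1set xH cards1 /=.
  by rewrite leqNgt; apply/negP => /(irr cH)/(_ rest); rewrite cA.
have FE : F = [set z].
  apply: single => //; first by split=> //; apply/subsetP => w; rewrite inE => /andP[].
  apply/card_gt1P; exists v, z'; rewrite nvz' !in_setD !in_setU (negPf vF) (negPf vA) vV z'V.
  by rewrite (negPf z'A) inE (negPf sep) andbF.
have GE : G = [set z'].
  apply: single => //; first by split=> //; apply/subsetP => w; rewrite !in_setD => /and3P[].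
  apply/card_gt1P; exists v, z; rewrite nvz !in_setD !in_setU /G !in_setD !in_set1.
  by rewrite !in_setU eqxx zF (negPf vA) (negPf zA) vV zV ?andbF.
have N x H : closed_up_to e H A -> H = [set x] -> x \in V -> nbhd e x = A.
  move=> cH HE xV; apply/eqP; rewrite eqEcard cA; apply/andP; split.
    apply/subsetP => w; rewrite inE => exw; have := cH x w.
    rewrite HE inE eqxx => /(_ isT exw); rewrite in_setU in_set1; case: eqP => // wx.
    by rewrite wx e_irr in exw.
  by have := cubic xV; rewrite /degree => ->.
have Nz := N z F cF FE zV; have Nz' := N z' G cG GE z'V.
have Na x : x \in A -> nbhd e x = [set v; z; z'].
  move=> xA; apply: cubic_nbhd; rewrite // 1?eq_sym //.
  - by rewrite e_sym; move: xA; rewrite -Nv inE.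
  - by rewrite e_sym; move: xA; rewrite -Nz inE.
  - by rewrite e_sym; move: xA; rewrite -Nz' inE.
have VE : V = [set v; z; z'] :|: A.
  apply/eqP; rewrite eqEsubset; apply/andP; split; apply/subsetP => w.
    move=> wV; have /setP/(_ w) := GE.
    rewrite /G !in_setD FE !in_setU !in_set1 wV.
    by case: (w == v); case: (w == z); case: (w == z'); case: (w \in A).
  rewrite !in_setU !in_set1 -!orbA => /or4P[/eqP->|/eqP->|/eqP->|] //.
  by rewrite -Nv inE; apply: eVr.
have c3 : #|[set v; z; z']| = 3 by rewrite -(Na a1 a1A); apply: (@cubic_degree a1 v); rewrite e_sym.
split.
  rewrite VE cardsU c3 cA; suff -> : [set v; z; z'] :&: A = set0 by rewrite cards0.
  apply/setP => w; rewrite !inE -!orbA; apply/negP => /andP[/or3P[]/eqP->]; exact/negP.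
exists v, z, a1, a2; split.
- have evz : ~~ e v z by move: zA; rewrite -Nv inE.
  by apply/and5P; split; rewrite // ?/degree ?Nv ?Nz ?cA.
- apply/and5P; split; rewrite ?/degree ?(Na _ a1A) ?(Na _ a2A) ?c3 //.
  have : a2 \notin nbhd e a1; last by rewrite inE.
  rewrite (Na _ a1A) !inE !negb_or -!andbA; apply/and3P; split.
  + by apply: contraNneq vA => <-.
  + by apply: contraNneq zA => <-.
  + by apply: contraNneq z'A => <-.
apply/pred0P => w; rewrite /= !inE; apply/negP => /andP[/orP[]/eqP-> /orP[]/eqP eqw].
- by rewrite eqw a1A in vA.
- by rewrite eqw a2A in vA.
- by rewrite eqw a1A in zA.
- by rewrite eqw a2A in zA.
Qed.

End Irreducible.

(** * Decidability of being a wheel center *)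

Section WheelDec.

Variables (T : finType) (e : rel T).

Definition wheelb v := [exists n : 'I_#|T|.+1, [exists C : n.-tuple T, is_wheel e C v]].

Lemma wheelP v : reflect (wheel_center e v) (wheelb v).
Proof.
apply: (iffP existsP) => [[n /existsP[C wC]]|[C wC]]; first by exists C.
have ltC : size C < #|T|.+1.
  have /and3P[/andP[_ /andP[_ uC]] _ _] := wC.
  by rewrite ltnS -(card_uniqP uC) max_card.
by exists (Ordinal ltC); apply/existsP; exists (in_tuple C).
Qed.

End WheelDec.

(** Every vertex is a neighbor of a non-center, hence cubic, and a theta around any non-center shows
    the graph to be K_{3,3}. *)
Lemma irreducible_twins (T : finType) (e : rel T) (V : {set T}) :
  symmetric e -> irreflexive e -> (forall x y, e x y -> x \in V) ->
  connected3 e V -> irreducible3 e V ->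
  (forall x y z, e x y -> e y z -> ~~ e z x) ->
  (forall u, u \in V -> exists2 v, e u v & ~ wheel_center e v) ->
  #|V| = 6 /\ exists u w x y : T,
    [/\ twins e u w, twins e x y & [disjoint [set u; w] & [set x; y]]].
Proof.
move=> e_sym e_irr eV conn irr tf nc.
have cubic u : u \in V -> degree e u = 3.
  case/nc => v euv nv; rewrite e_sym in euv.
  exact: (neighbor_of_noncenter_cubic e_sym e_irr eV conn irr tf euv nv).
have [cV _] := conn.
have /card_gt0P[u uV] : 0 < #|V| by apply: leq_trans cV.
have [v euv nv] := nc u uV; have vV := eVr e_sym eV euv.
have [a [b [c [ev neq]]]] := neighborsP e_irr conn vV.
have [z [z' [b1 [b2 [b3 th]]]]] := theta_exists e_sym e_irr eV conn tf nv ev neq.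
exact: (theta_K33 e_sym e_irr eV irr tf nv cubic th).
Qed.

Lemma cutC (T : finType) (e : rel T) (V F Z : {set T}) : symmetric e ->
  (forall x y, e x y -> x \in V) -> cut e V F Z -> cut e V (V :\: (F :|: Z)) Z.
Proof.
move=> e_sym eV [sFV dFZ cF]; split; first exact: subsetDl.
  by apply/pred0P => w /=; rewrite !inE; case: (w \in Z); rewrite ?orbT ?andbF.
move=> x y; rewrite !inE => /andP[/norP[xF xZ] xV] exy.
case: (boolP (y \in Z)) => [_|yZ]; first by rewrite orbT.
rewrite !orbF (eVr e_sym eV exy) andbT.
apply: contra xF => yF; have := cF y x yF; rewrite e_sym inE => /(_ exy).
by rewrite (negPf xZ) orbF.
Qed.

(** * Minimal fragments *)

Section Fragment.

Variables (T : finType) (e : rel T).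
Hypothesis e_sym : symmetric e.
Hypothesis e_irr : irreflexive e.
Hypothesis conn : connected3 e [set: T].
Hypothesis two_centers : forall x y z, wheel_center e x -> wheel_center e y ->
  wheel_center e z -> [/\ x != y, y != z & z != x] -> False.
Hypothesis centers_adj : forall x y, wheel_center e x -> wheel_center e y -> x != y ->
  e x y /\ degree e x = 3.
Implicit Types (F S Z H : {set T}) (x y z w s t u : T).

Let eT x y : e x y -> x \in [set: T]. Proof. by rewrite inE. Qed.

Let neq x y : e x y -> x != y. Proof. exact: adj_neq. Qed.

Lemma no_triangle x y z : e x y -> e y z -> ~~ e z x.
Proof.
move=> exy eyz; apply/negP => ezx; have tri := triangle_center e_sym e_irr eT conn.
by apply: (two_centers (tri _ _ _ exy eyz ezx) (tri _ _ _ eyz ezx exy)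
  (tri _ _ _ ezx exy eyz)); rewrite !neq.
Qed.

Variables F S : {set T}.
Variable r : T.
Hypothesis cutF : cut e [set: T] F S.
Hypothesis cardS : #|S| <= 3.
Hypothesis rFS : r \notin F :|: S.
Hypothesis F_minimal : forall H Z, cut e [set: T] H Z -> #|Z| <= 3 -> 1 < #|H| ->
  r \notin H :|: Z -> H \subset F -> F \subset H.

Lemma adj_FS x y : x \in F -> e x y -> y \in F :|: S.
Proof. by case: cutF => _ _; apply. Qed.

Lemma dFS x : x \in F -> x \notin S.
Proof. by case: cutF => _ dFS _ xF; rewrite (disjointFr dFS xF). Qed.

Lemma fragment_cut H Z x : H \subset F -> [disjoint H & Z] -> closed_up_to e H Z ->
  x \in H -> r \notin Z -> 2 < #|Z|.
Proof.
move=> sHF dHZ cH xH rZ; case: conn => _ h; apply: (h H Z x r) => //; rewrite ?inE //.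
rewrite (negPf rZ) orbF; apply: contra rFS => /(subsetP sHF) rF.
by rewrite inE rF.
Qed.

Hypothesis F_gt1 : 1 < #|F|.

Lemma cardS3 : #|S| = 3.
Proof.
have /card_gt0P[x xF] : 0 < #|F| by apply: ltnW.
case: cutF => _ d c; apply/eqP; rewrite eqn_leq cardS /=.
by apply: (fragment_cut (subxx F) d c xF); apply: contra rFS => rS; rewrite inE rS orbT.
Qed.

(** If [x] and [y] were adjacent, each would have two neighbors among the three vertices of [S], so
    a common one, and a triangle arises. Otherwise both have neighborhood [S]. *)
Lemma fragment_pair : ~~ (2 < #|F|) -> exists x y, [/\ x \in F, y \in F & twins e x y].
Proof.
rewrite -leqNgt => F2.
have /cards2P[x [y [nxy defF]]] : #|F| == 2 by rewrite eqn_leq F2 F_gt1.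
have deg u : 2 < #|nbhd e u|.
  have [a [b [c [[ha hb hc] abc]]]] := neighborsP e_irr conn (in_setT u).
  by apply/card_gt2P; exists a, b, c; rewrite !inE.
have sub u : u \in F -> nbhd e u \subset F :|: S.
  by move=> uF; apply/subsetP => w; rewrite [w \in nbhd _ _]inE; apply: adj_FS.
have xF : x \in F by rewrite defF !inE eqxx.
have yF : y \in F by rewrite defF !inE eqxx orbT.
have nexy : ~~ e x y.
  apply/negP => exy.
  have two u w : u \in F -> F = [set u; w] -> 1 < #|nbhd e u :&: S|.
    move=> uF Fuw; have : nbhd e u \subset w |: (nbhd e u :&: S).
      apply/subsetP => c cu; have := subsetP (sub u uF) c cu.
      rewrite !inE Fuw !inE -orbA; case: eqP => [cu'|_] /=.
        by move: cu; rewrite cu' inE e_irr.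
      by move: cu; rewrite inE => ->.
    by move/subset_leq_card; move: (deg u) (cardsU1 w (nbhd e u :&: S));
      case: (_ \notin _); count_lia.
  have : 0 < #|(nbhd e x :&: S) :&: (nbhd e y :&: S)|.
    have c1 := two x y xF defF; have := two y x yF; rewrite setUC => /(_ defF) c2.
    have := subset_leq_card (_ : (nbhd e x :&: S) :|: (nbhd e y :&: S) \subset S).
    move=> /(_ _); rewrite -setIUl subsetIr => /(_ isT); rewrite setIUl.
    by move: (cardsUI (nbhd e x :&: S) (nbhd e y :&: S)) c1 c2 cardS; count_lia.
  case/card_gt0P => s; rewrite !inE => /andP[/andP[exs _] /andP[eys _]].
  by have := no_triangle exy eys; rewrite e_sym exs.
have NS u : u \in F -> nbhd e u = S.
  move=> uF; apply/eqP; rewrite eqEcard cardS3 deg andbT; apply/subsetP => w wu.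
  have := subsetP (sub u uF) w wu; rewrite inE => /orP[wF|//].
  move: uF wF wu nexy; rewrite defF !inE => /orP[]/eqP-> /orP[]/eqP->; rewrite ?e_irr //.
    by move=> ->.
  by rewrite e_sym => ->.
exists x, y; split=> //; apply/and5P; split; rewrite ?/degree ?NS ?cardS3 //.
Qed.

Hypothesis F_gt2 : 2 < #|F|.

(** Otherwise the other two vertices of [S] separate [r] from [F]. *)
Lemma boundary_outer s : s \in S -> exists2 t, e s t & t \notin F :|: S.
Proof.
move=> sS; case: (pickP [pred t | e s t & t \notin F :|: S]) => [t /andP[]|h]; first by exists t.
have /card_gt0P[x xF] : 0 < #|F| by apply: ltnW.
have [_ c] := conn.
have : 2 < #|S :\ s|.
  apply: (c (~: (F :|: S)) (S :\ s) r x); rewrite ?inE //; last first.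
  - by rewrite xF /= (negPf (dFS xF)) andbF.
  - by move: rFS; rewrite inE.
  split; first exact: subsetT.
    by apply/pred0P => w /=; rewrite !inE; case: (w \in S); rewrite ?orbT ?andbF.
  move=> u w; rewrite !inE => uFS euw; case: (boolP (w \in F)) => wF.
    by rewrite e_sym in euw; have := adj_FS wF euw; rewrite inE (negPf uFS).
  case: (boolP (w \in S)) => //= wS; rewrite andbT; apply: contraNneq uFS => ws.
  by have := h u; rewrite /= -ws e_sym euw inE => /negbFE.
by move: (cardsD1 s S) cardS; rewrite sS; count_lia.
Qed.

(** With a single neighbor [d] in [F], moving [d] into the boundary in place of [s] would give a
    smaller fragment [F :\ d]. *)
Lemma boundary_inner s : s \in S -> 1 < #|nbhd e s :&: F|.
Proof.
move=> sS; rewrite ltnNge; apply/negP => le1.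
have [d dF sub] : exists2 d, d \in F & nbhd e s :&: F \subset [set d].
  case: (set_0Vmem (nbhd e s :&: F)) => [E|[d dN]].
    have /card_gt0P[x xF] : 0 < #|F| by apply: ltnW.
    by exists x; rewrite ?E ?sub0set.
  exists d; first by move: dN; rewrite inE => /andP[].
  have : [set d] == nbhd e s :&: F by rewrite eqEcard sub1set dN cards1.
  by move/eqP <-.
have cF1 : cut e [set: T] (F :\ d) (d |: (S :\ s)).
  split; first exact: subsetT.
    apply/pred0P => w /=; rewrite !inE; case: eqP => //= _; case wF: (w \in F) => //=.
    by rewrite (negPf (dFS wF)) andbF.
  move=> x y; rewrite !inE => /andP[xd xF] exy; have := adj_FS xF exy.
  rewrite inE; case: (eqVneq y d) => //= _; case: (boolP (y \in F)) => //= _ ->.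
  rewrite andbT; apply: contraNneq xd => ys; have := subsetP sub x; rewrite !inE xF.
  by rewrite -ys e_sym exy => /(_ isT).
have /subsetP/(_ d dF) : F \subset F :\ d; last by rewrite !inE eqxx.
apply: (F_minimal cF1).
- move: (cardsU1 d (S :\ s)) (cardsD1 s S) cardS; rewrite sS.
  by case: (_ \notin _); count_lia.
- by move: (cardsD1 d F) F_gt2; rewrite dF; count_lia.
- move: rFS; rewrite inE => /norP[rF rS].
  by rewrite !inE (negPf rF) (negPf rS) !andbF /= orbF; apply: contraNneq rF => ->.
exact: subD1set.
Qed.

(** * Collapsing the outside of a minimal fragment *)

Let W := F :|: S.
Let V' := r |: W.

(* The complement of [F :|: S] is collapsed to the single vertex [r]. *)
Definition capped : rel T :=
  [rel x y | [|| [&& x \in W, y \in W & e x y], (x == r) && (y \in S)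
               | (y == r) && (x \in S)]].
Local Notation e' := capped.

Lemma rS : r \notin S. Proof. by apply: contra rFS => rS; rewrite inE rS orbT. Qed.
Lemma rF : r \notin F. Proof. by apply: contra rFS => rF; rewrite inE rF. Qed.

Lemma capped_sym : symmetric e'.
Proof.
move=> x y; rewrite /capped /= e_sym andbCA; congr (_ || _).
by rewrite orbC.
Qed.

Lemma capped_irr : irreflexive e'.
Proof.
move=> x; rewrite /capped /= e_irr !andbF /= orbb; apply/andP => -[/eqP->].
by rewrite (negPf rS).
Qed.

Lemma capped_V x y : e' x y -> x \in V'.
Proof.
rewrite /V' in_setU1 /capped /= => /or3P[/and3P[-> _ _]|/andP[-> _]|/andP[_ xS]] //.
  by rewrite orbT.
by rewrite /W inE xS !orbT.
Qed.

Lemma cappedW x y : x != r -> y != r -> e' x y = [&& x \in W, y \in W & e x y].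
Proof. by move=> /negPf xr /negPf yr; rewrite /capped /= xr yr /= orbF. Qed.

Lemma capped_r x : e' r x = (x \in S).
Proof. by rewrite /capped /= /W (negPf rFS) eqxx (negPf rS) andbF orbF. Qed.

Lemma capped_F x y : x \in F -> e' x y = e x y.
Proof.
move=> xF; have xr : x != r by apply: contraTneq xF => ->; apply: rF.
rewrite /capped /= (negPf xr) (negPf (dFS xF)) andbF !orbF /W inE xF /=.
by apply/andP/idP => [[]|exy] //; rewrite (adj_FS xF exy).
Qed.

Lemma capped_closed H Z : H \subset F -> closed_up_to e' H Z -> closed_up_to e H Z.
Proof. by move=> sHF c x y xH exy; apply: (c x y xH); rewrite capped_F // (subsetP sHF). Qed.

(** A vertex of [S] in [H] would put its neighbor [r] into [H] or [Z]; so [H] lies in [F], where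
    both graphs have the same edges. *)
Lemma capped_avoid H Z : cut e' V' H Z -> r \notin H -> r \notin Z ->
  H \subset F /\ cut e [set: T] H Z.
Proof.
move=> [sHV dHZ c] rH rZ; have sHF : H \subset F.
  apply/subsetP => x xH; have := subsetP sHV x xH.
  rewrite !inE => /or3P[/eqP xr|//|xS]; first by rewrite -xr xH in rH.
  have := c x r xH; rewrite capped_sym capped_r => /(_ xS).
  by rewrite inE (negPf rH) (negPf rZ).
by split=> //; split; [apply: subsetT| |apply: capped_closed].
Qed.

(* Case where [r] lies in the separator: at most one vertex [s] of [S] is on
   the side [H], so trading [r] for [s] gives a separator of the original graph
   with side [H :\ s] inside [F].  The hypothesis covers both 3-connectivity
   (|Z| <= 2) and irreducibility (|Z| <= 3 with both sides large). *)
Lemma capped_cut_through_r H Z : cut e' V' H Z -> r \in Z -> #|Z| <= 2 + (1 < #|H|) ->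
  #|H :&: S| <= 1 ->
  1 < #|V' :\: (H :|: Z)| \/ #|Z| <= 2 -> 0 < #|H| -> False.
Proof.
move=> cH rZ cZ HS cH2 H0; have [sHV dHZ c] := cH.
have rH : r \notin H by rewrite (disjointFl dHZ rZ).
have cardZ : #|Z :\ r| <= 1 + (1 < #|H|) by move: (cardsD1 r Z) cZ; rewrite rZ; count_lia.
have inFS x : x \in H -> x \in F \/ x \in S.
  move=> xH; have := subsetP sHV x xH; rewrite !inE => /or3P[/eqP xr| |]; [|by left|by right].
  by rewrite -xr xH in rH.
case: (set_0Vmem (H :&: S)) => [HS0|[s]].
  (* Then [Z :\ r], of at most two vertices, already bounds [H] in the original graph. *)
  have sHF : H \subset F.
    apply/subsetP => x xH; case: (inFS x xH) => // xS.
    by have := in_set0 x; rewrite -HS0 inE xH xS.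
  have /card_gt0P[x xH] := H0.
  have : 2 < #|Z :\ r|.
    apply: (fragment_cut sHF _ _ xH); last by rewrite !inE eqxx.
      by apply: disjointWr dHZ; apply: subD1set.
    move=> a b aH eab; have := capped_closed sHF c aH eab; rewrite !inE.
    case: eqP => // br; have := adj_FS (subsetP sHF a aH) eab; rewrite br.
    by rewrite (negPf rFS).
  by move: cardZ; case: (1 < #|H|) => /=; count_lia.
rewrite inE => /andP[sH sS].
have only x : x \in H -> x \in S -> x = s.
  move=> xH xS; move/card_le1P: HS => /(_ s); rewrite inE sH sS => /(_ isT x).
  by rewrite !inE xH xS => /esym/eqP.
have sHF : H :\ s \subset F.
  apply/subsetP => x; rewrite !inE => /andP[xs xH]; case: (inFS x xH) => // xS.
  by rewrite (only x xH xS) eqxx in xs.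
have sZ : s \notin Z by rewrite (disjointFr dHZ sH).
pose Z1 := s |: (Z :\ r).
have cZ1 : #|Z1| <= 2 + (1 < #|H|).
  by move: (cardsU1 s (Z :\ r)) cardZ; rewrite /Z1;
    case: (_ \notin _); case: (1 < #|H|) => /=; count_lia.
have dZ1 : [disjoint H :\ s & Z1].
  apply/pred0P => w /=; rewrite !inE; case: (eqVneq w s) => //= _.
  by case wH: (w \in H) => //=; rewrite (disjointFr dHZ wH) andbF.
have c1 : closed_up_to e (H :\ s) Z1.
  move=> a b; rewrite /Z1 !inE => /andP[as_ aH] eab.
  have aF : a \in F by apply: (subsetP sHF); rewrite !inE as_.
  have := c a b aH; rewrite capped_F // => /(_ eab).
  have br : b != r by apply: contraTneq (adj_FS aF eab) => ->; apply: rFS.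
  by rewrite inE br; case: eqP.
have rZ1 : r \notin Z1.
  rewrite !inE eqxx /= orbF; apply: contraNneq rH => ->; exact: sH.
have Hs : nbhd e s :&: F \subset (H :\ s) :|: (Z :\ r).
  apply/subsetP => f; rewrite !inE => /andP[esf fF].
  have fs : f != s by apply: contraTneq fF => ->; apply: contraTN sS => /dFS.
  have fr : f != r by apply: contraTneq fF => ->; apply: rF.
  have sr : s != r by apply: contraNneq rS => <-.
  have := c s f sH; rewrite cappedW // /W !inE sS fF esf !orbT => /(_ isT).
  by rewrite fs fr.
have inner := boundary_inner sS.
(* If [H] is just [s], its two or more neighbors in [F] all lie in [Z :\ r], which then has at most
   one vertex. *)
have [H10|[x xH1]] := set_0Vmem (H :\ s).
  have H1 : #|H| = 1 by rewrite (cardsD1 s) sH H10 cards0.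
  move: inner; rewrite ltnNge => /negP[]; apply: leq_trans (subset_leq_card Hs) _.
  by rewrite H10 set0U; apply: leq_trans cardZ _; rewrite H1.
have gt2 := fragment_cut sHF dZ1 c1 xH1 rZ1.
have H_gt1 : 1 < #|H|.
  by move: (cardsD1 s H) (cardsD1 x (H :\ s)); rewrite sH xH1; count_lia.
rewrite H_gt1 in cZ cardZ cZ1.
have H2_gt1 : 1 < #|V' :\: (H :|: Z)|.
  case: cH2 => // Z2; move: gt2 (cardsU1 s (Z :\ r)) (cardsD1 r Z); rewrite rZ /Z1.
  by case: (_ \notin _) => /=; move: Z2; count_lia.
(* If [H :\ s] has two vertices, it contains [F] by minimality; a vertex of the other side is then
   in [S], and its neighbors in [F] are in [H], which is closed up to [Z]. *)
have [H1_gt1|H1_le1] := ltnP 1 #|H :\ s|.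
  have cut1 : cut e [set: T] (H :\ s) Z1 by split=> //; apply: subsetT.
  have rH1 : r \notin (H :\ s) :|: Z1 by rewrite inE (negPf rZ1) inE (negPf rH) andbF.
  have sFH := F_minimal cut1 cZ1 H1_gt1 rH1 sHF.
  have /card_gt0P[t] : 0 < #|V' :\: (H :|: Z)| by apply: ltnW.
  rewrite !inE => /andP[/norP[tH tZ] tV].
  have tS : t \in S.
    case/or3P: tV => [/eqP tr|tF|//]; first by rewrite tr rZ in tZ.
    by have := subsetP sFH t tF; rewrite inE (negPf tH) andbF.
  have /card_gt0P[f] : 0 < #|nbhd e t :&: F| by apply: ltnW (boundary_inner tS).
  rewrite !inE => /andP[etf fF]; have := subsetP sFH f fF; rewrite !inE => /andP[_ fH].
  have := c f t fH; rewrite capped_F // e_sym etf inE (negPf tH) (negPf tZ).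
  by move=> /(_ isT).
(* Now [x] has neighborhood [Z1], so it forms a triangle with [s] and a second neighbor [f] of [s]
   in [F]. *)
have H1E : H :\ s = [set x].
  by apply/eqP; rewrite eq_sym eqEcard sub1set xH1 cards1.
have nbx : nbhd e x = Z1.
  have [a [b [d [[ha hb hd] abd]]]] := neighborsP e_irr conn (in_setT x).
  have degx : 2 < #|nbhd e x| by apply/card_gt2P; exists a, b, d; rewrite !inE.
  apply/eqP; rewrite eqEcard (leq_trans cZ1 degx) andbT; apply/subsetP => w.
  rewrite inE => exw; have := c1 x w xH1 exw; rewrite H1E in_setU in_set1.
  by case: eqP => // wx; rewrite wx e_irr in exw.
have exs : e x s by have := setU11 s (Z :\ r); rewrite -/Z1 -nbx inE.
have [f] : exists f, f \in (nbhd e s :&: F) :\ x.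
  by apply/card_gt0P; move: (cardsD1 x (nbhd e s :&: F)) inner; case: (x \in _) => /=; count_lia.
rewrite in_setD1 => /andP[fx fN].
have := subsetP Hs f fN; rewrite H1E in_setU in_set1 (negPf fx) /=.
move=> fZ; have exf : e x f by have := setU1r s fZ; rewrite -/Z1 -nbx inE.
move: fN; rewrite !inE => /andP[esf _].
by have := no_triangle exs esf; rewrite e_sym exf.
Qed.

Lemma card_capped : #|V'| = #|F| + 4.
Proof.
rewrite /V' cardsU1 rFS /W; have [_ d _] := cutF.
by rewrite cardsU (disjoint_setI0 d) cards0 cardS3; lia.
Qed.

Lemma capped_split H Z :
  #|H :&: S| <= 1 \/ #|(V' :\: (H :|: Z)) :&: S| <= 1.
Proof.
have : #|H :&: S| + #|(V' :\: (H :|: Z)) :&: S| <= #|S|.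
  rewrite -(cardsID H S) setIC leq_add2l; apply/subset_leq_card/subsetP => w.
  by rewrite !inE => /andP[/andP[/norP[-> _] _] ->].
rewrite cardS3 => le3; case: (leqP #|H :&: S| 1) => h; [by left|right].
by move: le3 h; count_lia.
Qed.

Lemma capped_swap H Z : cut e' V' H Z -> cut e' V' (V' :\: (H :|: Z)) Z.
Proof. by apply: cutC; [apply: capped_sym|apply: capped_V]. Qed.

Lemma sub_capped_swap H Z : cut e' V' H Z ->
  H \subset V' :\: ((V' :\: (H :|: Z)) :|: Z).
Proof.
move=> [sHV dHZ _]; apply/subsetP => w wH.
rewrite in_setD in_setU in_setD [w \in H :|: Z]in_setU wH (disjointFr dHZ wH) /=.
exact: (subsetP sHV).
Qed.

(** If [r] is not in [Z], the side without [r] is cut off in the original graph too; otherwise use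
    the side with at most one vertex of [S]. *)
Lemma capped_connected : connected3 e' V'.
Proof.
split=> [|H Z x y cH xH yV yHZ]; first by rewrite card_capped; lia.
have yH2 : y \in V' :\: (H :|: Z) by rewrite in_setD yHZ yV.
have avoid H1 x1 : cut e' V' H1 Z -> x1 \in H1 -> r \notin H1 -> r \notin Z -> 2 < #|Z|.
  move=> cH1 xH1 rH1 rZ; have [sHF [_ d c]] := capped_avoid cH1 rH1 rZ.
  exact: (fragment_cut sHF d c xH1).
case: (boolP (r \in Z)) => rZ; last first.
  case: (boolP (r \in H)) => rH; last exact: (avoid H x).
  apply: (avoid _ y (capped_swap cH) yH2) => //.
  by rewrite in_setD in_setU rH.
rewrite ltnNge; apply/negP => Z2.
case: (capped_split H Z) => [h|h].
  apply: (capped_cut_through_r cH rZ _ h (or_intror Z2)); last by apply/card_gt0P; exists x.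
  by apply: leq_trans Z2 (leq_addr _ _).
apply: (capped_cut_through_r (capped_swap cH) rZ _ h (or_intror Z2)).
  by apply: leq_trans Z2 (leq_addr _ _).
by apply/card_gt0P; exists y.
Qed.

(** A large side [K] without [r] contains [F] by minimality. Every vertex of [S] has a neighbor in
    [F], so it is in [K] or [Z], and only [r] is left for the other side. *)
Lemma capped_irreducible : irreducible3 e' V'.
Proof.
move=> H Z cH H1 H2; rewrite ltnNge; apply/negP => Z3.
have cH' := capped_swap cH.
have H1' : 1 < #|V' :\: ((V' :\: (H :|: Z)) :|: Z)|.
  by apply: leq_trans H1 (subset_leq_card (sub_capped_swap cH)).
have avoid K : cut e' V' K Z -> 1 < #|K| -> 1 < #|V' :\: (K :|: Z)| ->
    r \notin K -> r \notin Z -> False.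
  move=> cK K1 K2 rK rZ; have [sKF cK'] := capped_avoid cK rK rZ.
  have sFK : F \subset K.
    by apply: (F_minimal cK' Z3 K1); rewrite // inE negb_or rK rZ.
  have [_ _ c] := cK; move: K2; rewrite ltnNge => /negP[].
  rewrite -(cards1 r); apply/subset_leq_card/subsetP => w.
  rewrite !inE => /andP[/norP[wK wZ]]; case: eqP => //= _ /orP[wF|wS].
    by rewrite (subsetP sFK) in wK.
  have /card_gt0P[f] := ltnW (boundary_inner wS).
  rewrite !inE => /andP[ewf fF]; have := c f w (subsetP sFK f fF).
  by rewrite capped_F // e_sym ewf inE (negPf wK) (negPf wZ) => /(_ isT).
case: (boolP (r \in Z)) => rZ; last first.
  case: (boolP (r \in H)) => rH; last exact: (avoid H).
  by apply: (avoid _ cH' H2 H1') => //; rewrite in_setD in_setU rH.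
case: (capped_split H Z) => [h|h].
  by apply: (capped_cut_through_r cH rZ _ h (or_introl H2)); rewrite ?H1 // ltnW.
by apply: (capped_cut_through_r cH' rZ _ h (or_introl H1')); rewrite ?H2 // ltnW.
Qed.

Lemma outer_path t p : t \notin W -> path e t p -> {in p, forall w, w \notin S} ->
  {in p, forall w, w \notin W}.
Proof.
elim: p t => //= u p IH t tW /andP[etu hp] pS.
have uW : u \notin W.
  rewrite /W inE negb_or pS ?inE ?eqxx // andbT; apply: contra tW => uF.
  by apply: (adj_FS uF); rewrite e_sym.
move=> w; rewrite inE => /predU1P[-> //|]; apply: (IH u uW hp) => c cp.
by apply: pS; rewrite inE cp orbT.
Qed.

(** A fan of three paths from [t] ends in all three vertices of [S]; the paths to [x] and [y] stay
    outside [W] before their ends. The result can replace [r] on a cycle. *)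
Lemma outer_detour t x y : t \notin W -> x \in S -> y \in S -> x != y -> exists q,
  [/\ path e x (rcons q y), uniq q, t \in q & {in q, forall w, w \notin W}].
Proof.
move=> tW xS yS nxy; have tS : t \notin S by move: tW; rewrite inE => /norP[].
have [I [u [b [z [cI hI dI xI]]]]] : legs e [set t] set0 S 3.
  apply: (connected_fan e_sym eT conn); rewrite ?inE ?cards0 ?cardS3 //.
  by rewrite disjoint_sym disjoints_subset sub0set.
have surj s : s \in S -> exists2 i, i \in I & z i = s.
  move=> sS; have : s \in [set z i | i in I]; last by case/imsetP => i iI ->; exists i.
  suff -> : [set z i | i in I] = S by [].
  apply/eqP; rewrite eqEcard cardS3 card_in_imset ?cI ?andbT.
    by apply/subsetP => c /imsetP[i /hI[_ []] _ _ zS _ _ ->].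
  move=> i j iI jI eqz; apply: (dI i j iI jI (z i)); rewrite ?eqz mem_rcons inE eqxx //.
have [i iI zi] := surj x xS; have [j jI zj] := surj y yS.
have [/set1P ui [hi ui' _ iS iD]] := hI i iI; have [/set1P uj [hj uj' _ jS jD]] := hI j jI.
rewrite ui zi in hi; rewrite uj zj in hj; rewrite zi in ui' iD; rewrite zj in uj' jD.
have nij : i != j by apply: contraNneq nxy => eqij; rewrite -zi -zj eqij.
have dis : {in b i, forall w, w \notin b j}.
  move=> w wi; apply: contra nij => wj; apply/eqP.
  by apply: (dI i j iI jI w); rewrite mem_rcons inE (wi, wj) orbT.
have notW b' s : path e t (rcons b' s) -> {in b', forall w, w \notin S} ->
    {in b', forall w, w \notin W}.
  by rewrite rcons_path => /andP[hb _]; apply: (outer_path tW hb).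
have tb b' s : {in rcons b' s, forall w, w \notin [set t] :|: set0} ->
    {in [:: t], forall w, w \notin b'}.
  move=> h w; rewrite inE => /eqP->; apply/negP => tb; have := h t.
  by rewrite mem_rcons inE tb orbT !inE eqxx => /(_ isT).
exists (rev (b i) ++ t :: b j); split.
- by rewrite path_mid -(path_rcons_rev e_sym) hi hj.
- apply/uniq_countP => w; move/uniq_countP/(_ w): ui'; move/uniq_countP/(_ w): uj'.
  have /uniq_countP/(_ w) : uniq [:: t] by [].
  move/disj_countP/(_ w): dis; move/disj_countP/(_ w): (tb _ _ iD).
  by move/disj_countP/(_ w): (tb _ _ jD); count_lia.
- by rewrite mem_cat inE eqxx orbT.
move=> w; rewrite mem_cat inE mem_rev => /or3P[wb|/eqP-> //|wb].
  exact: (notW _ _ hi iS).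
exact: (notW _ _ hj jS).
Qed.

(** A rim through [r] enters and leaves it by two vertices of [S]; a detour outside [W] between them
    replaces [r]. *)
Lemma capped_wheel w : wheel_center e' w -> w != r -> wheel_center e w.
Proof.
case=> C /and3P[/andP[sC /andP[cC uC]] wC /card_gt2P[a [b [c [[ha hb hc] abc]]]]] wr.
rewrite !inE in ha hb hc; case/andP: ha => aC ewa; case/andP: hb => bC ewb.
case/andP: hc => cC' ewc.
case: (boolP (r \in C)) => [rC|rC]; last first.
  have nr u : u \in C -> u != r by apply: contraTneq => ->.
  have ee x y : x != r -> y != r -> e' x y -> e x y.
    by move=> xr yr; rewrite cappedW // => /and3P[].
  apply: (@wheelI _ e C w a b c) => //; last by split; apply: ee => //; apply: nr.
  apply: (sub_in_cycle (P := [pred u | u != r]) _ _ cC).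
    by move=> x y xr yr; apply: ee.
  by apply/allP => u /nr.
have [i q def_C] := rot_to rC.
have eqC u : (u \in C) = (u == r) || (u \in q) by rewrite -(mem_rot i) def_C inE.
have : cycle e' (r :: q) by rewrite -def_C rot_cycle.
have : uniq (r :: q) by rewrite -def_C rot_uniq.
have : 2 < size (r :: q) by rewrite -def_C size_rot.
case: q def_C eqC => // x q; case/lastP: q => // q y def_C eqC _ uq.
rewrite [cycle _ _]/= rcons_path last_rcons => /and3P[erx hq eyr].
have xS : x \in S by rewrite -capped_r.
have yS : y \in S by rewrite -capped_r capped_sym.
have nxy : x != y.
  by move: uq; rewrite /= mem_rcons inE !negb_or => /and3P[_ /andP[]].
have rq : r \notin x :: rcons q y by move: uq => /andP[].
have nr u : u \in x :: rcons q y -> u != r by apply: contraTneq => ->.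
have hq' : path e x (rcons q y).
  apply: (sub_in_path (P := [pred u | u != r]) _ _ hq) => [u u' ur u'r|].
    by rewrite cappedW // => /and3P[].
  by apply/allP => u /nr.
have qW u : u \in x :: rcons q y -> u \in W.
  move=> uq'; have : u \in V'.
    have : u \in C by rewrite eqC uq' orbT.
    by move/(next_cycle cC)/capped_V.
  by rewrite /V' in_setU1 (negPf (nr u uq')).
have wW : w \in W by move: (capped_V ewa); rewrite /V' in_setU1 (negPf wr).
(* If [r] is a neighbor of the center, [w] is in [S] and has a neighbor [t] outside [W]; routing the
   detour through [t] keeps the number of spokes. Otherwise [r] itself serves as [t]. *)
have [t tW ewt] : exists2 t, t \notin W & w \in S -> e w t.
  case: (boolP (w \in S)) => [wS|_]; last by exists r.
  by have [t ewt tW] := boundary_outer wS; exists t.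
have [q' [hq'' uq' tq' q'W]] := outer_detour tW xS yS nxy.
pose C' := x :: q ++ y :: rev q'.
have qC' u : u \in x :: rcons q y -> u \in C'.
  by rewrite /C'; count_lia.
pose f u := if u == r then t else u.
have fP u : u \in C -> e' w u -> f u \in C' /\ e w (f u).
  rewrite eqC /f; case: eqP => [-> _|/eqP ur /= uq'' ewu].
    rewrite capped_sym capped_r => /ewt ewt'; split=> //.
    by rewrite inE mem_cat inE mem_rev tq' !orbT.
  by split; [apply: qC'|move: ewu; rewrite cappedW // => /and3P[]].
have f_neq u u' : u \in C -> u' \in C -> u != u' -> f u != f u'.
  rewrite !eqC /f; case: eqP => [->|/eqP ur] /=; case: eqP => [->|/eqP u'r] //=.
  - by rewrite eqxx.
  - by move=> _ /qW u'W _; apply: contraNneq tW => ->.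
  - by move=> /qW uW _ _; apply: contraNneq tW => <-.
have [ab bc ca] := abc.
have [fa efa] := fP a aC ewa; have [fb efb] := fP b bC ewb; have [fc efc] := fP c cC' ewc.
apply: (@wheelI _ e C' w (f a) (f b) (f c)) => //.
- exact: (cycle_of_paths e_sym hq' hq'').
- have /disj_countP dis : {in q', forall u, u \notin x :: rcons q y}.
    by move=> u /q'W uW; apply: contra uW; apply: qW.
  apply/uniq_countP => u; move/uniq_countP/(_ u): uq; move/uniq_countP/(_ u): uq'.
  by move: (dis u); rewrite /C'; count_lia.
- have wq : w \notin x :: rcons q y by move: wC; rewrite eqC => /norP[].
  have wq' : w \notin q' by apply/negP => /q'W; rewrite wW.
  by move: wq wq'; rewrite /C'; count_lia.
- by split=> //; apply: f_neq.
Qed.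

(** A triangle with [r] has two adjacent vertices of [S], both centers in the original graph and so
    of degree 3; but each has two neighbors in [F], one in [S] and one outside. A triangle without
    [r] gives three centers. *)
Lemma capped_triangle_free x y z : e' x y -> e' y z -> ~~ e' z x.
Proof.
have neq' u u' : e' u u' -> u != u' by apply: (adj_neq capped_irr).
have no_r u u' : e' r u -> e' u u' -> e' u' r -> False.
  move=> eru euu' eu'r.
  have cu := triangle_center capped_sym capped_irr capped_V capped_connected euu' eu'r eru.
  have cu' := triangle_center capped_sym capped_irr capped_V capped_connected eu'r eru euu'.
  have ur : u != r by rewrite eq_sym neq'.
  have u'r : u' != r by rewrite neq'.
  have [_ deg3] := centers_adj (capped_wheel cu ur) (capped_wheel cu' u'r) (neq' _ _ euu').
  rewrite capped_r in eru; rewrite capped_sym capped_r in eu'r.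
  have /and3P[_ _ euu] : [&& u \in W, u' \in W & e u u'] by rewrite -cappedW.
  have [t eut tW] := boundary_outer eru; rewrite inE in tW; case/norP: tW => tF tS.
  have : #|t |: (u' |: (nbhd e u :&: F))| <= degree e u.
    apply/subset_leq_card/subsetP => c; rewrite !inE.
    by case/or3P => [/eqP->|/eqP->|/andP[]].
  rewrite !cardsU1 !inE (negPf tF) andbF orbF deg3.
  have -> : u' \in F = false by apply: contraTF eu'r => /dFS.
  have -> : t == u' = false by apply: contraNF tS => /eqP->.
  by rewrite andbF /=; move: (boundary_inner eru); count_lia.
move=> exy eyz; apply/negP => ezx.
have tri := triangle_center capped_sym capped_irr capped_V capped_connected.
have [xr|xr] := eqVneq x r; first by apply: (no_r y z); rewrite -?xr.
have [yr|yr] := eqVneq y r; first by apply: (no_r z x); rewrite -?yr.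
have [zr|zr] := eqVneq z r; first by apply: (no_r x y); rewrite -?zr.
apply: (two_centers (capped_wheel (tri _ _ _ exy eyz ezx) xr)
  (capped_wheel (tri _ _ _ eyz ezx exy) yr) (capped_wheel (tri _ _ _ ezx exy eyz) zr)).
by rewrite !neq'.
Qed.

(** Two of three neighbors of [u] differ from [r]. If both were centers, they would be adjacent and
    form a triangle with [u]. *)
Lemma capped_noncenter u : u \in V' -> exists2 v, e' u v & ~ wheel_center e' v.
Proof.
move=> uV; have [p [q [t [[ep eq et] [pq qt tp]]]]] := neighborsP capped_irr capped_connected uV.
case: (wheelP e' p) => [cp|]; last by exists p.
case: (wheelP e' q) => [cq|]; last by exists q.
case: (wheelP e' t) => [ct|]; last by exists t.
have two x y : e' u x -> e' u y -> wheel_center e' x -> wheel_center e' y ->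
    x != y -> x != r -> y != r -> False.
  move=> eux euy cx cy nxy xr yr.
  have [exy _] := centers_adj (capped_wheel cx xr) (capped_wheel cy yr) nxy.
  have inW c : e' u c -> c != r -> c \in W.
    by rewrite capped_sym => /capped_V; rewrite /V' in_setU1 => /predU1P[->|//]; rewrite eqxx.
  have exy' : e' x y by rewrite cappedW // exy !inW.
  by have := capped_triangle_free eux exy'; rewrite capped_sym euy.
have [pr|pr] := eqVneq p r.
  by exfalso; apply: (two q t); rewrite // -pr // eq_sym.
have [qr|qr] := eqVneq q r.
  by exfalso; apply: (two t p); rewrite // -qr // eq_sym.
by exfalso; apply: (two p q).
Qed.

(** The collapsed graph has 6 vertices, of which [r] and [S] are four, so [F] has only two. *)
Lemma large_fragment_absurd : False.
Proof.
have [c6 _] := irreducible_twins capped_sym capped_irr capped_V capped_connected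
  capped_irreducible capped_triangle_free capped_noncenter.
by move: card_capped F_gt2; rewrite c6; count_lia.
Qed.

End Fragment.

(** * Twins on both sides of a cut *)

Section Main.

Variables (T : finType) (e : rel T).
Hypothesis e_sym : symmetric e.
Hypothesis e_irr : irreflexive e.

(** A path that avoids [Z] and starts in [F] never leaves [F]. *)
Lemma k_connected3 : k_connected e 3 -> connected3 e [set: T].
Proof.
move=> [cT c]; split=> [|F Z x y [_ dFZ cF] xF _ yFZ]; first by rewrite cardsT.
rewrite ltnNge; apply/negP => Z2; move: yFZ; rewrite inE => /norP[yF yZ].
have /connectP[p] : connect (del_rel e Z) x y.
  by apply: c; rewrite // (disjointFr dFZ xF).
elim: p x xF => [|u p IH] x xF /=; first by move=> _ yx; rewrite yx xF in yF.
move=> /andP[/and3P[_ uZ exu] hp]; apply: IH hp.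
by have := cF x u xF exu; rewrite inE (negPf uZ) orbF.
Qed.

Hypothesis conn : connected3 e [set: T].
Hypothesis two_centers : forall x y z, wheel_center e x -> wheel_center e y ->
  wheel_center e z -> [/\ x != y, y != z & z != x] -> False.
Hypothesis centers_adj : forall x y, wheel_center e x -> wheel_center e y -> x != y ->
  e x y /\ degree e x = 3.

(** Induction on the size of [F]: if [F] contains no twins, neither does any smaller fragment inside
    it, so [F] is minimal. *)
Lemma fragment_twins (F S : {set T}) r : cut e [set: T] F S -> #|S| <= 3 -> 1 < #|F| ->
  r \notin F :|: S -> exists x y, [/\ x \in F, y \in F & twins e x y].
Proof.
have [n] := ubnP #|F|; elim: n F S => // n IH F S ltF cutF cS F1 rFS.
have [/existsP[x /existsP[y /and3P[xF yF txy]]]|noT] :=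
  boolP [exists x, exists y, [&& x \in F, y \in F & twins e x y]]; first by exists x, y.
exfalso.
have Fmin H Z : cut e [set: T] H Z -> #|Z| <= 3 -> 1 < #|H| -> r \notin H :|: Z ->
    H \subset F -> F \subset H.
  move=> cH cZ H1 rHZ sHF; apply/negPn/negP => nsFH.
  have ltH : #|H| < n.
    by rewrite -ltnS; apply: leq_trans ltF; rewrite ltnS; apply: proper_card; rewrite /proper sHF.
  have [x [y [xH yH txy]]] := IH H Z ltH cH cZ H1 rHZ.
  case/negP: noT; apply/existsP; exists x; apply/existsP; exists y.
  by rewrite txy !(subsetP sHF).
case: (boolP (2 < #|F|)) => F2.
  exact: (large_fragment_absurd e_sym e_irr conn two_centers centers_adj cutF cS rFS Fmin F1 F2).
have [x [y [xF yF txy]]] := fragment_pair e_sym e_irr conn two_centers cutF cS rFS F1 F2.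
by case/negP: noT; apply/existsP; exists x; apply/existsP; exists y; rewrite xF yF.
Qed.

Lemma two_pairs_of_twins : exists u v x y : T,
  [/\ twins e u v, twins e x y & [disjoint [set u; v] & [set x; y]]].
Proof.
have eT x y : e x y -> x \in [set: T] by rewrite inE.
(* Look for a cut by at most three vertices with two or more vertices on both sides; its sides,
   being disjoint, give disjoint pairs. *)
case: (pickP [pred p : {set T} * {set T} | [&& [disjoint p.1 & p.2],
    [forall x in p.1, forall y, e x y ==> (y \in p.1 :|: p.2)],
    #|p.2| <= 3, 1 < #|p.1| & 1 < #|[set: T] :\: (p.1 :|: p.2)|]]).
  case=> F S /= /and5P[dFS /forall_inP cl cS F1 R1].
  have cutF : cut e [set: T] F S.
    by split=> [|//|x y xF exy]; [apply: subsetT|have /forallP/(_ y)/implyP := cl x xF; apply].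
  have /card_gt0P[r rR] := ltnW R1; have /card_gt0P[x xF] := ltnW F1.
  have rFS : r \notin F :|: S by move: rR; rewrite in_setD => /andP[].
  have xRS : x \notin ([set: T] :\: (F :|: S)) :|: S.
    by rewrite !inE xF (disjointFr dFS xF).
  have [a [b [aF bF tab]]] := fragment_twins cutF cS F1 rFS.
  have [c [d [cR dR tcd]]] := fragment_twins (cutC e_sym eT cutF) cS R1 xRS.
  exists a, b, c, d; split=> //; apply/pred0P => w; rewrite /= !inE; apply/negP.
  move=> /andP[/orP wab /orP wcd].
  have wF : w \in F by case: wab => /eqP->.
  have : w \in [set: T] :\: (F :|: S) by case: wcd => /eqP->.
  by rewrite !inE wF.
move=> noCut; have tf := no_triangle e_sym e_irr conn two_centers.
have irr : irreducible3 e [set: T].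
  move=> F Z [_ dFZ cF] F1 R1; rewrite ltnNge; apply/negP => Z3.
  have := noCut (F, Z); rewrite /= dFZ Z3 F1 R1 !andbT.
  by move/forall_inP; apply => x xF; apply/forallP => y; apply/implyP; apply: cF.
(* Of three neighbors of [u], at most two are centers. *)
have nc u : u \in [set: T] -> exists2 v, e u v & ~ wheel_center e v.
  move=> uT; have [p [q [t [[ep eq et] neq]]]] := neighborsP e_irr conn uT.
  case: (wheelP e p) => [cp|]; last by exists p.
  case: (wheelP e q) => [cq|]; last by exists q.
  case: (wheelP e t) => [ct|]; last by exists t.
  by case: (two_centers cp cq ct neq).
by have [_] := irreducible_twins e_sym e_irr eT conn irr tf nc.
Qed.

End Main.

Theorem theorem6p6 (T : finType) (e : rel T)
    (e_sym : symmetric e) (e_irr : irreflexive e)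
    (e_awf : almost_wheel_free e) (e_3conn : k_connected e 3) :
  exists u v x y : T,
    [/\ twins e u v, twins e x y & [disjoint [set u; v] & [set x; y]]].
Proof.
apply: two_pairs_of_twins => //; first exact: k_connected3.
  (* In every case there are at most two centers, and two distinct ones are adjacent and of degree
     3. *)
  case: e_awf => [no|[u _ W]|[u [v [_ _ _ W]]]] x y z.
  - by move/no.
  - by move=> /W-> /W-> _ []; rewrite eqxx.
  by move=> /W[]-> /W[]-> /W[]-> []; rewrite ?eqxx.
case: e_awf => [no|[u _ W]|[u [v [euv du dv W]]]] x y.
- by move/no.
- by move=> /W-> /W->; rewrite eqxx.
by move=> /W[]-> /W[]->; rewrite ?eqxx // e_sym.
Qed.
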